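(* If $G$ is a graph with $\mathrm{mad}(G)<3$, then $\chi_o(G)\le 6$. This includes all planar graphs of girth at least $6$; that is, every planar graph $G$ of girth at least $6$ satisfies $\mathrm{mad}(G)<3$, and hence $\chi_o(G)\le 6$.
   Context: All graphs are finite, simple and have at least one vertex. A proper coloring of a graph $G$ is called odd if every non-isolated vertex $v$ has some color that appears an odd number of times on its (open) neighborhood $N(v)$. The smallest number of colors in an odd coloring of $G$ is denoted $\chi_o(G)$. The maximum average degree of $G$ is $\mathrm{mad}(G):=\max_{H\subseteq G}2|E(H)|/|V(H)|$, the maximum being over all non-empty subgraphs $H$ of $G$. The girth of a graph is the length of a shortest cycle; the girth of an acyclic graph is infinite. *)

(* Defs.v *)
From HB Require Import structures.
From mathcomp Require Import all_boot all_order all_algebra.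

Set Implicit Arguments.
Unset Strict Implicit.
Unset Printing Implicit Defensive.

Import Order.TTheory GRing.Theory Num.Theory.

Local Open Scope ring_scope.

Record sgraph := SGraph {
  vertex :> finType;
  adj : rel vertex;
  adj_sym : symmetric adj;
  adj_irrefl : irreflexive adj;
  vertex_gt0 : (0 < #|vertex|)%N
}.

Definition edges (G : sgraph) : {set {set G}} :=
  [set [set e.1; e.2] | e : G * G & adj e.1 e.2].

Definition proper_coloring (G : sgraph) (k : nat) (c : {ffun G -> 'I_k}) : bool :=
  [forall u, forall v, adj u v ==> (c u != c v)].

Definition odd_coloring (G : sgraph) (k : nat) (c : {ffun G -> 'I_k}) : bool :=
  proper_coloring c &&
  [forall v, [exists u, adj v u] ==>
     [exists i, odd #|[set u | adj v u & c u == i]|]].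

Definition odd_colorable (G : sgraph) (k : nat) : bool :=
  [exists c : {ffun G -> 'I_k}, odd_coloring c].

Lemma odd_colorable_card (G : sgraph) : exists k, odd_colorable G k.
Proof.
exists #|G|; apply/existsP; exists [ffun v => enum_rank v]; apply/andP; split.
  apply/forallP => u; apply/forallP => v; apply/implyP => uv.
  rewrite !ffunE (inj_eq enum_rank_inj); apply/eqP => E.
  by move: uv; rewrite E adj_irrefl.
apply/forallP => v; apply/implyP => /existsP[u vu]; apply/existsP.
exists (enum_rank u).
rewrite (_ : [set w | _ & _] = [set u]) ?cards1 //.
apply/setP => w; rewrite !inE ffunE (inj_eq enum_rank_inj).
by case: eqP => [->|]; rewrite ?vu // andbF.
Qed.

Definition odd_chromatic_number (G : sgraph) : nat :=
  ex_minn (odd_colorable_card G).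

(* A non-empty subgraph of [G], not necessarily induced, as the pair of its
   vertex set and its edge set. *)
Definition nonempty_subgraph (G : sgraph) (H : {set G} * {set {set G}}) : bool :=
  [&& H.1 != set0, H.2 \subset edges G & [forall f in H.2, f \subset H.1]].

(* The index set is never empty and the terms are nonnegative, so the default
   value 0 does not affect the maximum. *)
Definition mad (G : sgraph) : rat :=
  \big[Num.max/0]_(H : {set G} * {set {set G}} | nonempty_subgraph H)
    ((2 * #|H.2|)%:R / #|H.1|%:R).

Definition is_cycle (G : sgraph) (s : seq G) : bool :=
  (2 < size s)%N && ucycleb (@adj G) s.

From mathcomp Require Import all_classical all_reals all_analysis.

Import numFieldNormedType.Exports.

Local Open Scope classical_set_scope.

(* The infimum of the empty set is [+oo], the girth of an acyclic graph. *)
Definition girth (R : realType) (G : sgraph) : \bar R :=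
  ereal_inf [set (size s)%:R%:E | s in [set s : seq G | is_cycle s]].

Definition is_arc (R : realType) (A : set (R * R)) (x y : R * R) : Prop :=
  exists gamma : R -> R * R,
    [/\ {within `[0, 1], continuous gamma},
        {in `[0, 1] &, injective gamma},
        gamma 0 = x, gamma 1 = y & A = gamma @` `[0, 1]].

(* [p v] is the point representing [v], and [A f] the arc representing the
   edge [f]; the values of [A] outside [edges G] are irrelevant.  The interior
   of an arc contains no vertex and no point of any other edge. *)
Definition plane_drawing (R : realType) (G : sgraph)
    (p : G -> R * R) (A : {set G} -> set (R * R)) : Prop :=
  injective p /\
  forall u v : G, adj u v ->
    let f := [set u; v]%SET in
    let open_arc := A f `\` [set p u; p v] in
    [/\ is_arc (A f) (p u) (p v),
        forall w : G, ~ open_arc (p w) &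
        forall g, g \in edges G -> g != f -> open_arc `&` A g = set0].

Definition planar (R : realType) (G : sgraph) : Prop :=
  exists (p : G -> R * R) (A : {set G} -> set (R * R)), plane_drawing p A.

(* Main.v *)
Require Import Defs.
From mathcomp Require Import all_boot all_order all_algebra.
From mathcomp Require Import zify ring lra.
From mathcomp Require Import all_classical all_reals all_analysis.
(* Several names on finite sets denote lemmas on classical sets otherwise. *)
From mathcomp Require Import ssrbool eqtype fintype bigop finset.

(** The theorem combines two independent facts: graphs of maximum average
degree less than 3 are odd 6-colorable, and planar graphs of girth at least 6
have maximum average degree less than 3.

Coloring. A vertex of odd degree sees some color an odd number of times
whatever the coloring, and two neighbors of a vertex of degree 2 satisfy it
exactly when their colors differ. Adding a vertex v to a coloring, each
neighbor w of v excludes at most two colors: the color of w, and the one color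
that would leave w without a color seen an odd number of times
([color_vertex]). Delete a vertex u of degree d together with t of its
neighbors of degree 2. When u is colored again, it has to avoid two colors for
each of its d - t other neighbors, and only one for each deleted neighbor,
namely the color of the other end of that neighbor; this works if 2d - t <= 5,
and the deleted neighbors are easy to color afterwards ([reducible]). If no
such u exists, moving a charge 1/2 from each vertex to each of its neighbors of
degree 2 shows that the average degree is at least 3 ([sparse_odd_coloring]).

Planarity. The bound on the number of edges of a planar graph is the usual
count of faces, with the faces replaced by a family generating the cycle space
over F_2 in which every edge belongs to at most two members, as in the
planarity criterion of MacLane. Such a family has at least |E| - |V| + 1
nonempty members; each of them contains a cycle, hence has at least 6 edges,
and so 6 (|E| - |V| + 1) <= 2 |E| ([two_fold_generated_bound]).

The unit cells of the square lattice form such a family for the lattice: a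
lattice cycle is the sum of the cells in which the number of its vertical bonds
on the left is odd ([discrete_jordan], a discrete Jordan curve theorem). This
passes to minors. Deleting a bond merges the two cells that it separates, and
contracting it projects the cycle space ([lattice_minor_bound]).

It remains to see a plane drawing as a minor of a lattice
([planar_lattice_model]). Cut each arc into thirds. The star of a vertex, made
of the outer thirds at that vertex, and the middle thirds of the arcs are
compact sets that meet only where a middle third leaves its two stars. On a
sufficiently fine lattice the blocks of sites around disjoint sets among them
are therefore disjoint, and the blocks along a curve are connected. The branch
set of a vertex is made of the sites around its star, together with the sites
around the middle thirds of some of its edges that can be reached from there
without entering the star at the other end. *)

Set Implicit Arguments.
Unset Strict Implicit.
Unset Printing Implicit Defensive.

Import Order.TTheory GRing.Theory Num.Theory.
Import numFieldNormedType.Exports.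

(** * Odd colorings of sparse graphs *)

Section SparseColoring.
Variables (V : finType) (e : rel V).
Hypotheses (e_sym : symmetric e) (e_irr : irreflexive e).

Implicit Types (S T : {set V}) (c : V -> 'I_6).

Definition nbhd S v := [set w in S | e v w].

Lemma in_nbhd S v w : (w \in nbhd S v) = (w \in S) && e v w.
Proof. by rewrite inE. Qed.

Definition odd_at S c v := [exists i, odd #|[set w in nbhd S v | c w == i]|].

Definition proper_on S c := {in S &, forall v w, e v w -> c v != c w}.

Definition odd_coloring_on S c :=
  proper_on S c /\ {in S, forall v, nbhd S v != set0 -> odd_at S c v}.

Definition recolor c v a : V -> 'I_6 := fun x => if x == v then a else c x.

(** The color classes partition a neighborhood of odd size, so they cannot all
be even. *)
Lemma odd_at_odd_degree S c v : odd #|nbhd S v| -> odd_at S c v.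
Proof.
apply: contraLR => no_odd.
rewrite -sum1_card (partition_big c predT) //= -dvdn2.
apply: dvdn_sum => i _; rewrite dvdn2; apply: contra no_odd => oi.
apply/existsP; exists i; rewrite -sum1_card; congr (odd _): oi.
by apply: eq_bigl => w; rewrite !inE.
Qed.

Lemma odd_at_two S c v x y :
  nbhd S v = [set x; y] -> c x != c y -> odd_at S c v.
Proof.
move=> nv cxy; apply/existsP; exists (c x); rewrite nv.
rewrite (_ : [set _ in _ | _] = [set x]) ?cards1 //.
apply/setP => w; rewrite !inE; case: (eqVneq w x) => [->|_] /=.
  by rewrite eqxx.
by apply/andP => -[/eqP-> /eqP yx]; rewrite yx eqxx in cxy.
Qed.

Lemma odd_at_not_adjacent S c v a w :
  ~~ e w v -> odd_at (v |: S) (recolor c v a) w = odd_at S c w.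
Proof.
move=> wv; apply: eq_existsb => i; congr (odd _); apply: eq_card => x.
rewrite !inE /recolor; case: (eqVneq x v) => [->|_] //=.
by rewrite (negPf wv) andbF.
Qed.

Lemma nbhd_not_adjacent S v w : ~~ e w v -> nbhd (v |: S) w = nbhd S w.
Proof.
move=> wv; apply/setP => x; rewrite !inE.
by case: (eqVneq x v) => [->|_] //=; rewrite (negPf wv) andbF.
Qed.

(** Giving color [a] to a new neighbor of [w] changes at [w] the parity of [a]
alone. If some color is odd at [w], only that color can do harm; if none is,
the new color becomes odd. *)
Lemma odd_at_adjacent S c v w :
    v \notin S -> e w v ->
  exists o, forall a, a != o -> odd_at (v |: S) (recolor c v a) w.
Proof.
move=> vS wv.
have count a i : #|[set x in nbhd (v |: S) w | recolor c v a x == i]| =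
    (a == i) + #|[set x in nbhd S w | c x == i]|.
  rewrite (cardsD1 v) !inE eqxx /= wv /recolor eqxx; congr (_ + _).
  apply: eq_card => x; rewrite !inE.
  by case: (eqVneq x v) => [->|_] //=; rewrite (negPf vS).
have [/existsP[i odd_i]|no_odd] := boolP (odd_at S c w).
  exists i => a ai; apply/existsP; exists i.
  by rewrite count (negPf ai).
exists (c w) => a _; apply/existsP; exists a; rewrite count eqxx /=.
by apply: contra no_odd => oa; apply/existsP; exists a.
Qed.

(** Each neighbor excludes at most two colors, its own and the one given by
[odd_at_adjacent]. The set [forb] carries the constraints that come from
vertices to be colored later. *)
Lemma color_vertex S c v (forb : {set 'I_6}) :
    v \notin S -> proper_on S c -> 2 * #|nbhd S v| + #|forb| < 6 ->
  exists a, [/\ a \notin forb, proper_on (v |: S) (recolor c v a) &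
    forall w, w \in S -> e w v -> odd_at (v |: S) (recolor c v a) w].
Proof.
move=> vS cS few.
have /fin_all_exists[sp spP] w : exists sp, e w v ->
    forall a, a != sp -> odd_at (v |: S) (recolor c v a) w.
  case: (boolP (e w v)) => [wv|_]; last by exists (c w).
  by have [sp spP] := odd_at_adjacent c vS wv; exists sp.
pose bad := forb :|: (c @: nbhd S v :|: sp @: nbhd S v).
have /subsetPn[a _ a_ok] : ~~ ([set: 'I_6] \subset bad).
  apply/negP => /subset_leq_card; rewrite cardsT card_ord leqNgt => /negP[].
  apply: leq_ltn_trans few; apply: leq_trans (leq_card_setU _ _) _.
  rewrite addnC leq_add2r; apply: leq_trans (leq_card_setU _ _) _.
  by rewrite mul2n -addnn leq_add ?leq_imset_card.
move: a_ok; rewrite !inE !negb_or => /and3P[a_forb a_c a_sp].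
exists a; split => // [x y|w wS wv].
  have a_new z : z \in S -> e v z -> a != c z.
    by move=> zS vz; apply: contraNneq a_c => ->; rewrite imset_f // !inE zS.
  rewrite !inE /recolor.
  case: (eqVneq x v) => [->|_] /=; case: (eqVneq y v) => [->|_] //=.
  - by rewrite e_irr.
  - by move=> _ yS; apply: a_new.
  - by move=> xS _ xv; rewrite eq_sym; apply: a_new; rewrite // e_sym.
  - exact: cS.
apply: spP => //; apply: contraNneq a_sp => ->.
by rewrite imset_f // !inE wS e_sym.
Qed.

(** The vertex [u] is colored first. For a neighbor outside [T] it avoids two
colors; for [t] in [T] it avoids only the color of the other neighbor of [t],
which makes [t] satisfied. Then the vertices of [T] follow, each with two
colored neighbors. Coloring any of them repairs the parity at [u]; if [T] is
empty, that parity has to be harmless for another reason. *)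
Lemma reducible S u T :
    u \in S -> T \subset nbhd S u -> {in T, forall t, #|nbhd S t| = 2} ->
    {in T &, forall t t', ~~ e t t'} ->
    2 * #|nbhd S u| <= #|T| + 5 ->
    [|| T != set0, odd #|nbhd S u| | nbhd S u == set0] ->
    (exists c, odd_coloring_on (S :\: (u |: T)) c) ->
  exists c, odd_coloring_on S c.
Proof.
move=> uS TN T2 Tind few u_ok [c0 [c0_proper c0_odd]].
set S0 := S :\: (u |: T) in c0_proper c0_odd.
have TS t : t \in T -> (t \in S) * (e u t).
  by move=> /(subsetP TN); rewrite !inE => /andP[].
have uT : u \notin T by apply/negP => /TS[_]; rewrite e_irr.
have S0S : S0 \subset S by apply: subsetDl.
have /fin_all_exists[w wP] t : exists w, t \in T ->
    nbhd S t = [set u; w] /\ w \in S0.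
  case: (boolP (t \in T)) => tT; last by exists u.
  have ut : u \in nbhd S t by rewrite inE uS e_sym (TS t tT).
  have := T2 t tT; rewrite (cardsD1 u) ut => -[] /eqP/cards1P[w wE].
  exists w => _; split; first by rewrite -wE setD1K.
  have : w \in nbhd S t :\ u by rewrite wE set11.
  rewrite !inE negb_or => /and3P[-> -> tw] /=; rewrite andbT.
  by apply/negP => wT; move: (Tind t w tT wT); rewrite tw.
have uS0 : u \notin S0 by rewrite !inE eqxx.
(* A neighbor of u outside T counts twice, a vertex of T once. *)
have few0 : 2 * #|nbhd S0 u| + #|[set c0 (w t) | t in T]| < 6.
  have -> : nbhd S0 u = nbhd S u :\: T.
    apply/setP => x; rewrite !inE negb_or.
    case: (eqVneq x u) => [->|_]; rewrite ?e_irr ?andbF //=.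
    by rewrite andbA.
  have forb_le : #|[set c0 (w t) | t in T]| <= #|T| by apply: leq_imset_card.
  have := cardsID T (nbhd S u); rewrite (setIidPr TN) => dE.
  by rewrite -dE in few; move: few forb_le; clear; lia.
have [a [a_forb c1_proper c1_odd]] := color_vertex uS0 c0_proper few0.
pose S1 := u |: S0; pose c1 := recolor c0 u a.
have wu t : t \in T -> w t != u.
  by move=> /wP[_]; apply: contraTneq => ->.
(* The vertex u has to see an odd color only once a vertex of T is colored:
   coloring u itself takes no account of the parity at u. *)
have extend (s : seq V) : uniq s -> {subset s <= T} ->
    exists c, [/\ proper_on (S1 :|: [set x in s]) c,
      {in T, forall t, c u != c (w t)},
      {in S0 :|: [set x in s], forall x, nbhd (S1 :|: [set x in s]) x != set0 ->
         odd_at (S1 :|: [set x in s]) c x} &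
      s != [::] -> odd_at (S1 :|: [set x in s]) c u].
  elim: s => [_ _|t s IHs /= /andP[ts s_uniq] sT].
    exists c1; rewrite set_nil !setU0; split => // [t tT|x xS0 xN].
      rewrite /c1 /recolor /= eqxx (negPf (wu t tT)).
      by apply: contraNneq a_forb => ->; apply: imset_f.
    have [xu|xu] := boolP (e x u); first exact: c1_odd.
    rewrite odd_at_not_adjacent //; apply: c0_odd => //.
    by rewrite nbhd_not_adjacent in xN.
  have tT : t \in T by apply: sT; rewrite mem_head.
  have {}sT : {subset s <= T} by move=> x xs; apply: sT; rewrite inE xs orbT.
  have [c [c_proper c_w c_odd c_u]] := IHs s_uniq sT.
  have tu : t != u by apply: contraNneq uT => <-.
  set S2 := S1 :|: [set x in s] in c_proper c_odd c_u *.
  have S2_cons : S1 :|: [set x in t :: s] = t |: S2 by rewrite set_cons setUCA.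
  have tS2 : t \notin S2 by rewrite !inE tT (negPf tu) (negPf ts).
  have [tN wS0] := wP t tT.
  have S2S : S2 \subset S.
    apply/subsetP => x; rewrite in_setU in_setU1.
    move=> /orP[/orP[/eqP->//|/(subsetP S0S)//]|].
    by rewrite inE => /sT/TS[].
  have tN2 : nbhd S2 t = [set u; w t].
    rewrite -tN; apply/setP => x; rewrite !in_nbhd.
    case: (boolP (e t x)) => tx; rewrite ?andbF ?andbT //.
    apply/idP/idP => [|xS]; first exact: (subsetP S2S).
    have : x \in nbhd S t by rewrite in_nbhd xS.
    by rewrite tN => /set2P[]->; rewrite /S2 /S1 !in_setU ?wS0 ?set11 ?orbT.
  have few2 : 2 * #|nbhd S2 t| + #|(set0 : {set 'I_6})| < 6.
    by rewrite tN2 cards0 cards2; case: eqP.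
  have [b [_ c'_proper c'_odd]] := color_vertex tS2 c_proper few2.
  exists (recolor c t b); rewrite S2_cons; split => // [x xT|x|_].
  - rewrite /recolor [u == t]eq_sym (negPf tu).
    case: (eqVneq (w x) t) => [wt|_]; last exact: c_w.
    by have [_] := wP x xT; rewrite wt !inE tT orbT.
  - rewrite set_cons setUCA in_setU1 => /predU1P[->|xS2] xN; last first.
      have xS2' : x \in S2 by rewrite /S2 /S1 -setUA in_setU xS2 orbT.
      have [xt|xt] := boolP (e x t); first exact: c'_odd.
      rewrite odd_at_not_adjacent //; apply: c_odd => //.
      by rewrite nbhd_not_adjacent in xN.
    rewrite odd_at_not_adjacent ?e_irr //.
    exact: odd_at_two tN2 (c_w t tT).
  - by apply: c'_odd; rewrite ?inE ?eqxx // (TS t tT).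
have [//|c [c_proper _ c_odd c_u]] := extend (enum T) (enum_uniq _).
  by move=> x; rewrite mem_enum.
have SE : S1 :|: [set x in enum T] = S.
  apply/setP => x; rewrite !inE mem_enum.
  case: (eqVneq x u) => [->|_]; rewrite ?uS //=.
  by case: (boolP (x \in T)) => [/TS[->]|_] //=; rewrite orbF.
rewrite SE in c_proper c_odd c_u.
exists c; split=> // x xS xN; have [xu|xu] := eqVneq x u.
  subst x; case/or3P: u_ok => [T0|dodd|d0].
  - apply: c_u; apply: contraNneq T0 => T0; apply/eqP/setP => x.
    by rewrite -mem_enum T0 inE.
  - exact: odd_at_odd_degree.
  - by rewrite d0 in xN.
by apply: c_odd => //; move: xS; rewrite -SE !inE (negPf xu).
Qed.

(** Discharging. In a subgraph without a reducible vertex, no two vertices of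
degree 2 are adjacent, and any other vertex, of degree [d] with [t] neighbors
of degree 2, satisfies [t + 6 <= 2 * d]. Since each vertex of degree 2 has two
neighbors, the sum of [t] is twice the number of these vertices, which is what
they lack to satisfy the same inequality. *)
Lemma sparse_odd_coloring :
    (forall S, S != set0 -> \sum_(v in S) #|nbhd S v| < 3 * #|S|) ->
  forall S, exists c, odd_coloring_on S c.
Proof.
move=> sparse S; have [n] := ubnP #|S|; elim: n S => // n IHn S Sn.
have [->|S_n0] := eqVneq S set0.
  by exists (fun=> ord0); split => [x y|x]; rewrite inE.
pose two := [set v in S | #|nbhd S v| == 2].
have [/existsP[u /existsP[T /and5P[uS TN T2 Tind /andP[few ok]]]]|no_red] :=
  boolP [exists u, exists T : {set V}, [&& u \in S, T \subset nbhd S u,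
    T \subset two, [forall t in T, forall t' in T, ~~ e t t'],
    2 * #|nbhd S u| <= #|T| + 5 &
    [|| T != set0, odd #|nbhd S u| | nbhd S u == set0]]].
  apply: (reducible uS TN) few ok _.
  - by move=> t /(subsetP T2); rewrite inE => /andP[_ /eqP].
  - by move=> t t' tT t'T; move/forall_inP: Tind => /(_ t tT)/forall_inP; apply.
  - apply: IHn; apply: leq_trans (_ : #|S| <= n) => //.
    apply: proper_card; apply/properP; split; first exact: subsetDl.
    by exists u; rewrite // !inE eqxx.
have irred u T : u \in S -> T \subset nbhd S u -> T \subset two ->
    {in T &, forall t t', ~~ e t t'} ->
    [|| T != set0, odd #|nbhd S u| | nbhd S u == set0] ->
    #|T| + 6 <= 2 * #|nbhd S u|.
  move=> uS TN T2 Tind ok; rewrite addnS ltnNge.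
  apply: contra no_red => few; apply/existsP; exists u; apply/existsP; exists T.
  rewrite uS TN T2 few ok /= !andbT.
  by do 2!apply/forall_inP => ? ?; apply: Tind.
have two_ind : {in two &, forall t t', ~~ e t t'}.
  move=> t t' t2; have := t2; rewrite inE => /andP[tS /eqP dt] t'2.
  apply/negP => tt'; have /(_ tS) := irred t [set t'].
  rewrite dt cards1 !sub1set t'2 inE tt' (subsetP _ _ t'2); last first.
    by apply/subsetP => x; rewrite inE => /andP[].
  have -> : [set t'] != set0 by rewrite -card_gt0 cards1.
  have ind1 : {in [set t'] &, forall x y, ~~ e x y}.
    by move=> x y /set1P-> /set1P->; rewrite e_irr.
  by move=> /(_ isT isT ind1 isT).
have charge u : u \in S ->
    #|nbhd S u :&: two| + 6 <= 2 * #|nbhd S u| + 2 * (u \in two).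
  move=> uS; have T2 := subsetIr (nbhd S u) two.
  have TN := subsetIl (nbhd S u) two.
  have Tind : {in nbhd S u :&: two &, forall t t', ~~ e t t'}.
    by move=> t t' /(subsetP T2) ? /(subsetP T2) ?; apply: two_ind.
  have := irred u _ uS TN T2 Tind.
  have [u2|u2] := boolP (u \in two).
    have -> : nbhd S u :&: two = set0.
      apply/setP => x; rewrite in_setI in_nbhd in_set0.
      by apply/negP => /andP[/andP[_ ux] /(two_ind u x u2)]; rewrite ux.
    by move: u2; rewrite inE cards0 => /andP[_ /eqP->].
  have : #|nbhd S u| != 2 by move: u2; rewrite inE uS.
  rewrite -!cards_eq0; move: #|_ :&: _| #|nbhd S u| => t d.
  by case: t d => [|t] [|[|[|d]]] //=; lia.
have two_sum : \sum_(u in S) #|nbhd S u :&: two| = 2 * #|two|.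
  transitivity (\sum_(u in S) \sum_(t in two) (e u t : nat)).
    apply: eq_bigr => u uS; rewrite -sum1_card [RHS]big_mkcond /=.
    rewrite big_mkcond; apply: eq_bigr => t _; rewrite !inE.
    by case: (t \in S); case: (e u t); case: (_ == 2).
  rewrite exchange_big /= mulnC -sum_nat_const; apply: eq_bigr => t.
  rewrite inE => /andP[tS /eqP <-].
  rewrite -sum1_card big_mkcond [RHS]big_mkcond.
  apply: eq_bigr => u _; rewrite inE e_sym.
  by case: (u \in S); case: (e t u).
have two_card : \sum_(u in S) (u \in two : nat) = #|two|.
  rewrite -sum1_card big_mkcond [RHS]big_mkcond; apply: eq_bigr => u _.
  by rewrite inE; case: (u \in S); case: (_ == _).
have : \sum_(u in S) (#|nbhd S u :&: two| + 6) <=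
       \sum_(u in S) (#|nbhd S u| + #|nbhd S u| + ((u \in two) + (u \in two))).
  by apply: leq_sum => u /charge; rewrite !mul2n -!addnn.
rewrite !big_split /= two_sum sum_nat_const two_card.
by have := sparse S S_n0; lia.
Qed.

End SparseColoring.

Local Open Scope ring_scope.

(** * Cycle spaces generated by a two-fold family *)

(** The vectors [bnd f] generate the space of cycles, the kernel of the
incidence map. That map has rank less than [#|V|], because every edge has its
two ends in [V] and therefore the all-ones vector is orthogonal to its image.
So there are at least [#|E| - #|V| + 1] nonzero vectors [bnd f], and counting
the pairs of an edge and a vector in which it occurs gives the bound. *)
Lemma two_fold_generated_bound (Et Vt Ft : finType) (E : {set Et})
    (V : {set Vt}) (inc : Et -> Vt -> 'F_2) (bnd : Ft -> Et -> 'F_2) :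
    V != set0 ->
    {in E, forall e, \sum_(v in V) inc e v = 0} ->
    (forall z : Et -> 'F_2,
       {in V, forall v, \sum_(e in E) z e * inc e v = 0} ->
     exists W : Ft -> 'F_2, {in E, forall e, z e = \sum_f W f * bnd f e}) ->
    {in E, forall e, (#|[set f | bnd f e != 0%R]| <= 2)%N} ->
    (forall f, [exists e in E, bnd f e != 0] ->
       (6 <= #|[set e in E | bnd f e != 0%R]|)%N) ->
  (2 * #|E| < 3 * #|V|)%N.
Proof.
move=> V_n0 inc2 gen two_fold long.
pose Fs := [set f | [exists e in E, bnd f e != 0]].
pose A : 'M['F_2]_(#|E|, #|V|) := \matrix_(i, j) inc (enum_val i) (enum_val j).
pose B : 'M['F_2]_(#|Fs|, #|E|) := \matrix_(i, j) bnd (enum_val i) (enum_val j).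
have rank_A : (\rank A < #|V|)%N.
  have A1 : A *m (const_mx 1 : 'cV_#|V|) = 0.
    apply/matrixP => i j; rewrite !mxE -[RHS](inc2 _ (enum_valP i)).
    rewrite [RHS]big_enum_val /=; apply: eq_bigr => k _.
    by rewrite !mxE mulr1.
  have := mulmx0_rank_max A1; apply: leq_trans; rewrite -addn1 leq_add2l.
  rewrite lt0n mxrank_eq0; apply/eqP => /matrixP.
  have [v vV] := set0Pn _ V_n0.
  by move=> /(_ (enum_rank_in vV v) 0); rewrite !mxE => /eqP; rewrite oner_eq0.
have ker_B : (kermx A <= B)%MS.
  apply/row_subP => k; have := row_sub k (kermx A).
  move: (row k _) => z /sub_kermxP zA.
  (* gen speaks of functions on all of Et, so z is extended by zero. *)
  pose z' e := \sum_(i < #|E| | enum_val i == e) z 0 i.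
  have z'E i : z' (enum_val i) = z 0 i.
    by rewrite /z' (big_pred1 i) // => i'; rewrite (inj_eq enum_val_inj).
  have [v vV|W WP] := gen z'.
    move/matrixP: zA => /(_ 0 (enum_rank_in vV v)).
    rewrite !mxE => z0; rewrite -[RHS]z0.
    rewrite [LHS]big_enum_val; apply: eq_bigr => i _.
    by rewrite z'E !mxE enum_rankK_in.
  have -> : z = (\row_i W (enum_val i)) *m B; last exact: submxMl.
  apply/rowP => i; rewrite mxE -z'E (WP _ (enum_valP i)).
  under [RHS]eq_bigr do rewrite !mxE.
  rewrite -(big_enum_val (fun f => W f * bnd f (enum_val i))) /=.
  rewrite [RHS]big_mkcond.
  apply: eq_bigr => f _; case: ifPn => //; rewrite inE => no_e.
  have [->|f_e] := eqVneq (bnd f (enum_val i)) 0; first by rewrite mulr0.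
  by case/exists_inP: no_e; exists (enum_val i); rewrite ?enum_valP.
have := mxrankS ker_B; rewrite mxrank_ker => dimE.
have {dimE} dimF := leq_trans dimE (rank_leq_row B).
have : (6 * #|Fs| <= 2 * #|E|)%N.
  rewrite !(mulnC _ #|_|) -!sum_nat_const.
  apply: (@leq_trans (\sum_(f in Fs) \sum_(e in E) (bnd f e != 0%R))%N).
    apply: leq_sum => f; rewrite inE => /long /leq_trans; apply.
    rewrite -sum1_card big_mkcond [leqRHS]big_mkcond leq_sum // => e _.
    by rewrite inE; case: (e \in E); case: (_ != 0).
  rewrite exchange_big /=; apply: leq_sum => e eE.
  apply: leq_trans (two_fold e eE).
  rewrite -sum1_card big_mkcond [leqRHS]big_mkcond leq_sum // => f _.
  by rewrite inE; case: (f \in Fs); case: (_ != 0).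
by move: dimF rank_A; set r := \rank A; lia.
Qed.

(** Extend a path at its head [x0] by a neighbor different from the successor
[y0] of [x0]; such a neighbor exists because the degree of [x0] is not 1. When
this neighbor already lies on the path, it closes a cycle. *)
Lemma cycle_of_degree_neq1 (V : finType) (r : rel V) (x y : V) :
    symmetric r -> irreflexive r -> (forall v, #|[set w | r v w]| != 1)%N ->
    r x y ->
  exists s, (2 < size s)%N && ucycleb r s.
Proof.
move=> r_sym r_irr deg xy.
suff grow n x0 y0 p : (#|V| < n + size p)%N -> uniq [:: x0, y0 & p] ->
    path r x0 (y0 :: p) -> exists s, (2 < size s)%N && ucycleb r s.
  apply: (grow #|V|.+1 x y [::]) => //=; first by rewrite addn0.
    by rewrite inE andbT; apply: contraTneq xy => ->; rewrite r_irr.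
  by rewrite xy.
elim: n x0 y0 p => [|n IHn] x0 y0 p.
  move=> Vp /card_uniqP p_uniq; have := max_card (mem [:: x0, y0 & p]).
  by rewrite p_uniq /= => /ltnW/ltnW; rewrite leqNgt Vp.
move=> Vp p_uniq p_path; have /= /andP[x0y0 _] := p_path.
have [z x0z zy0] : exists2 z, r x0 z & z != y0.
  have := deg x0; rewrite (cardsD1 y0) inE x0y0 add1n eqSS cards_eq0.
  by case/set0Pn => z; rewrite !inE => /andP[]; exists z.
have zx0 : z != x0 by apply: contraTneq x0z => ->; rewrite r_irr.
have [zp|zp] := boolP (z \in p); last first.
  apply: (IHn z x0 (y0 :: p)); first by rewrite /= addnS -addSn.
    by rewrite cons_uniq p_uniq !inE (negPf zx0) (negPf zy0) (negPf zp).
  by rewrite /= r_sym x0z.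
move: p_uniq p_path; case/splitPr: zp => p1 p2.
rewrite -cat_rcons => p_uniq p_path.
exists [:: x0, y0 & rcons p1 z]; rewrite /= size_rcons /=; apply/andP; split.
  move: p_path; rewrite /= x0y0 /= cat_path rcons_path => /andP[pz _].
  by rewrite rcons_path last_rcons r_sym x0z rcons_path pz.
move: p_uniq; rewrite /= !inE !mem_cat !negb_or cat_uniq.
by case/and3P=> /and3P[-> -> _] /andP[-> _] /andP[->].
Qed.

Section EdgeSets.
Variables (V : finType) (z : {set {set V}}).
Hypothesis z2 : forall f, f \in z -> #|f| = 2%N.

Lemma card_neighbors v :
  #|[set w | [set v; w] \in z]| = #|[set f in z | v \in f]|.
Proof.
have inj : {in [set w | [set v; w] \in z] &, injective (fun w => [set v; w])}.
  move=> w w'; rewrite !inE => vw vw' /setP/(_ w); rewrite !inE eqxx orbT.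
  by move=> /esym/orP[]/eqP // wv; move: (z2 vw); rewrite wv setUid cards1.
rewrite -(card_in_imset inj); apply: eq_card => f; rewrite [RHS]inE.
apply/imsetP/andP => [[w]|[fz vf]].
  by rewrite inE => vw ->; rewrite !inE eqxx.
have /eqP := z2 fz; rewrite (cardsD1 v) vf eqSS => /cards1P[w fw].
have fE : f = [set v; w] by rewrite -fw setD1K.
by exists w; rewrite // inE -fE.
Qed.

Lemma sum_degrees : (\sum_v #|[set w | [set v; w] \in z]| = 2 * #|z|)%N.
Proof.
under eq_bigr do rewrite card_neighbors.
have -> : (2 * #|z| = \sum_(f in z) #|f|)%N.
  by rewrite mulnC -sum_nat_const; apply: eq_bigr => h /z2.
under [RHS]eq_bigr do rewrite -sum1_card.
under eq_bigr do rewrite -sum1_card.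
rewrite [RHS](exchange_big_dep predT) //=; apply: eq_bigr => v _.
by apply: eq_bigl => h; rewrite inE.
Qed.

(** The set contains a cycle, and each of the [g] or more vertices of that
cycle has degree at least two in [z], so the degrees add up to at least twice
[g]. *)
Lemma even_edge_set_large (g : nat) :
    z != set0 -> (forall v, ~~ odd #|[set f in z | v \in f]|) ->
    (forall s, (2 < size s)%N -> ucycleb (fun v w => [set v; w] \in z) s ->
       (g <= size s)%N) ->
  (g <= #|z|)%N.
Proof.
move=> z_n0 z_even z_girth.
pose r v w := [set v; w] \in z.
have r_sym : symmetric r by move=> v w; rewrite /r setUC.
have r_irr : irreflexive r.
  by move=> v; apply/negP => /z2; rewrite setUid cards1.
have deg v : #|[set w | r v w]| != 1%N.
  by rewrite card_neighbors; apply: contra (z_even v) => /eqP->.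
have [f fz] := set0Pn _ z_n0.
have /eqP/cards2P[x [y [_ fE]]] := z2 fz.
have rxy : r x y by rewrite /r -fE.
have [s /andP[s3 s_cycle]] := cycle_of_degree_neq1 r_sym r_irr deg rxy.
apply: leq_trans (z_girth s s3 s_cycle) _.
have /andP[s_cyc s_uniq] := s_cycle.
rewrite -(leq_pmul2l (isT : 0 < 2)%N) -sum_degrees -(card_uniqP s_uniq) mulnC.
rewrite -sum_nat_const big_mkcond leq_sum // => v _; case: ifP => // vs.
have := next_cycle s_cyc vs; have := deg v.
rewrite (cardsD1 (next s v)) inE => + rv; rewrite rv.
by case: #|_|.
Qed.

End EdgeSets.

(** * Chains on the square lattice *)

Lemma addxx_F2 (x : 'F_2) : x + x = 0.
Proof. exact: addrr_pchar2 (pchar_Fp _) x. Qed.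

Lemma F2_neq0 (x : 'F_2) : (x != 0) -> x = 1.
Proof. by case: x => [[|[|]]] // ? _; apply: val_inj. Qed.

Lemma natr_F2 (n : nat) : n%:R = (odd n)%:R :> 'F_2.
Proof. by rewrite -{1}[n]odd_double_half natrD -addnn natrD addxx_F2 addr0. Qed.

(** A site is a point of the square lattice. The bond [(true, (i, j))] is
horizontal and [(false, (i, j))] vertical; both start at [(i, j)]. A cell is
named by its lower left site. *)
Notation site := (nat * nat)%type.
Notation bond := (bool * site)%type.

Definition end1 (l : bond) : site := l.2.
Definition end2 (l : bond) : site :=
  if l.1 then (l.2.1.+1, l.2.2) else (l.2.1, l.2.2.+1).
Definition cell1 (l : bond) : site := l.2.
Definition cell2 (l : bond) : site :=
  if l.1 then (l.2.1, l.2.2.-1) else (l.2.1.-1, l.2.2).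

Definition site_adj (x y : site) : Prop :=
  exists l, (x = end1 l /\ y = end2 l) \/ (x = end2 l /\ y = end1 l).

Inductive linked (Y : site -> Prop) (x : site) : site -> Prop :=
| linked_refl : linked Y x x
| linked_step y z : linked Y x y -> site_adj y z -> Y z -> linked Y x z.

(** The boundary of a chain of bonds modulo 2. Predecessors are truncated at 0,
so the value is meaningful only at sites with positive coordinates. *)
Definition divergence (q : bond -> 'F_2) (x : site) : 'F_2 :=
  q (true, x) + q (true, (x.1.-1, x.2)) +
  (q (false, x) + q (false, (x.1, x.2.-1))).

Lemma divergence_sum (I : finType) (P : pred I) (a : I -> 'F_2)
    (q : I -> bond -> 'F_2) x :
  divergence (fun l => \sum_(i | P i) a i * q i l) x =
  \sum_(i | P i) a i * divergence (q i) x.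
Proof.
by rewrite /divergence -!big_split /=; apply: eq_bigr => i _; rewrite !mulrDr.
Qed.

Lemma divergence_bond (l : bond) (x : site) :
    (0 < l.2.1)%N -> (0 < l.2.2)%N -> (0 < x.1)%N -> (0 < x.2)%N ->
  divergence (fun l' => (l' == l)%:R) x = (x == end1 l)%:R + (x == end2 l)%:R.
Proof.
case: l x => b [i j] [[|k] [|m]] //= i0 j0 _ _.
rewrite /divergence /end1 /end2 /=.
case: b; rewrite !xpair_eqE /= ?addr0 ?add0r.
  by congr (_ + _); rewrite eqSS.
by congr (_ + _); rewrite eqSS.
Qed.

(** The sum modulo 2 of the bonds of a lattice path from [a] to [b]. *)
Lemma linked_chain (X : pred site) (a b : site) :
    (forall x, X x -> (0 < x.1)%N /\ (0 < x.2)%N) ->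
    X a -> linked X a b ->
  exists q : bond -> 'F_2,
    (forall l, q l != 0 -> X (end1 l) && X (end2 l)) /\
    (forall x, (0 < x.1)%N -> (0 < x.2)%N ->
       divergence q x = (x == a)%:R + (x == b)%:R).
Proof.
move=> X_gt0 Xa ab.
suff [//] : X b /\ exists q : bond -> 'F_2,
    (forall l, q l != 0 -> X (end1 l) && X (end2 l)) /\
    (forall x, (0 < x.1)%N -> (0 < x.2)%N ->
       divergence q x = (x == a)%:R + (x == b)%:R).
elim: ab => [|y z _ [Xy [q [qX qdiv]]] [l yz] Xz].
  split => //; exists (fun=> 0); split => [l|x _ _]; first by rewrite eqxx.
  by rewrite addxx_F2 /divergence !addr0.
split => //; exists (fun l' => q l' + (l' == l)%:R).
have Xl : X (end1 l) && X (end2 l) by case: yz => -[<- <-]; apply/andP.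
split => [l' | x x1 x2].
  by case: (eqVneq l' l) => [->|_] //; rewrite addr0; apply: qX.
have [l1 l2] := X_gt0 _ (proj1 (andP Xl)).
transitivity (divergence q x + divergence (fun l' => (l' == l)%:R) x).
  by rewrite /divergence; ring.
rewrite qdiv // divergence_bond //.
have -> : (x == end1 l)%:R + (x == end2 l)%:R =
    (x == y)%:R + (x == z)%:R :> 'F_2.
  by case: yz => -[-> ->] //; rewrite addrC.
by rewrite -addrA [X in _ + X]addrA addxx_F2 add0r.
Qed.

(** The function [W] counts the vertical bonds of [z] between a cell and the
left border of its row. It changes by definition across the vertical bonds of
[z]. The change across a horizontal bond is the sum of [z] over the vertical
bonds that end on the line of that bond to its left; since the divergence of
[z] vanishes along this line, the sum telescopes to the value of [z] at the
bond. *)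
Lemma discrete_jordan (z : bond -> 'F_2) :
    (forall l, z l != 0 -> (0 < l.2.1)%N && (0 < l.2.2)%N) ->
    (forall x, (0 < x.1)%N -> (0 < x.2)%N -> divergence z x = 0) ->
  exists W : site -> 'F_2, forall l, z l = W (cell1 l) + W (cell2 l).
Proof.
move=> z_supp z_div.
have z0 b i : z (b, (0%N, i)) = 0.
  by apply/eqP; apply: contraTT isT => /z_supp.
have z0' b i : z (b, (i, 0%N)) = 0.
  by apply/eqP; apply: contraTT isT => /z_supp; rewrite andbF.
exists (fun c => \sum_(k < c.1.+1) z (false, (k : nat, c.2))).
case=> -[] [i j]; rewrite /cell1 /cell2 /=; last first.
  case: i => [|i] /=; first by rewrite z0 addxx_F2.
  by rewrite big_ord_recr /= addrAC addxx_F2 add0r.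
case: j => [|j] /=; first by rewrite z0' addxx_F2.
rewrite -big_split /=; elim: i => [|i IHi].
  by rewrite big_ord1 !z0 addr0.
rewrite big_ord_recr /= -IHi; have /= := z_div (i.+1, j.+1) isT isT.
rewrite /divergence /= => /eqP.
rewrite -addrA addr_eq0 (oppr_pchar2 (pchar_Fp _)) //.
by move/eqP.
Qed.

Lemma sum_shift (n : nat) (F : nat -> 'F_2) :
  F 0%N = 0 -> F n = 0 -> \sum_(i < n) F i = \sum_(i < n) F i.+1.
Proof.
move=> F0 Fn; transitivity (\sum_(i < n.+1) F i).
  by rewrite big_ord_recr /= Fn addr0.
by rewrite big_ord_recl F0 add0r.
Qed.

Definition of_ord (n : nat) (c : 'I_n * 'I_n) : site := (c.1 : nat, c.2 : nat).

(** Summation by parts. The index shifts lose nothing, since [X] avoids both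
borders of the square. *)
Lemma sum_flux (n : nat) (X : pred site) (chi : bond -> 'F_2) :
    (forall x, X x -> (0 < x.1 < n)%N && (0 < x.2 < n)%N) ->
  \sum_(l : bool * ('I_n * 'I_n))
     chi (l.1, of_ord l.2) *
       ((X (end1 (l.1, of_ord l.2)))%:R + (X (end2 (l.1, of_ord l.2)))%:R) =
  \sum_(x : 'I_n * 'I_n) (X (of_ord x))%:R * divergence chi (of_ord x).
Proof.
move=> X_range.
have X0 i j : (X (i, j)) -> [&& 0 < i, i < n, 0 < j & j < n]%N.
  by move/X_range => /= /andP[/andP[-> ->] /andP[-> ->]].
rewrite -(pair_bigA _ (fun b (c : 'I_n * 'I_n) => chi (b, of_ord c) *
       ((X (end1 (b, of_ord c)))%:R + (X (end2 (b, of_ord c)))%:R))) /=.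
rewrite big_bool /=.
rewrite -(pair_bigA _ (fun i j : 'I_n => chi (true, (i : nat, j : nat)) *
   ((X (i : nat, j : nat))%:R + (X (i.+1, j : nat))%:R))) /=.
rewrite -(pair_bigA _ (fun i j : 'I_n => chi (false, (i : nat, j : nat)) *
   ((X (i : nat, j : nat))%:R + (X (i : nat, j.+1))%:R))) /=.
rewrite -(pair_bigA _ (fun i j : 'I_n => (X (i : nat, j : nat))%:R *
   divergence chi (i : nat, j : nat))) /=.
have h_shift :
    \sum_(i < n) \sum_(j < n) chi (true, (i : nat, j : nat)) *
      (X (i.+1, j : nat))%:R =
    \sum_(i < n) \sum_(j < n) (X (i : nat, j : nat))%:R *
      chi (true, (i.-1, j : nat)).
  rewrite exchange_big [RHS]exchange_big /=; apply: eq_bigr => j _.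
  rewrite [RHS](sum_shift
    (F := fun i => (X (i, j : nat))%:R * chi (true, (i.-1, j : nat)))).
  - by apply: eq_bigr => i _; rewrite mulrC.
  - by case: (boolP (X _)) => [/X0//|_]; rewrite mul0r.
  - by case: (boolP (X _)) => [/X0|_]; rewrite ?ltnn ?andbF // mul0r.
have v_shift :
    \sum_(i < n) \sum_(j < n) chi (false, (i : nat, j : nat)) *
      (X (i : nat, j.+1))%:R =
    \sum_(i < n) \sum_(j < n) (X (i : nat, j : nat))%:R *
      chi (false, (i : nat, j.-1)).
  apply: eq_bigr => i _.
  rewrite [RHS](sum_shift
    (F := fun j => (X (i : nat, j))%:R * chi (false, (i : nat, j.-1)))).
  - by apply: eq_bigr => j _; rewrite mulrC.
  - by case: (boolP (X _)) => [/X0/and4P[]//|_]; rewrite mul0r.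
  - by case: (boolP (X _)) => [/X0|_]; rewrite ?ltnn ?andbF // mul0r.
under eq_bigr do (under eq_bigr do rewrite mulrDr; rewrite big_split /=).
rewrite big_split /= h_shift.
under [X in _ + X]eq_bigr do
  (under eq_bigr do rewrite mulrDr; rewrite big_split /=).
rewrite [X in _ + X]big_split /= v_shift -!big_split /=; apply: eq_bigr => i _.
rewrite -!big_split /=; apply: eq_bigr => j _.
by rewrite /divergence /= ; ring.
Qed.

(** * Minors of the square lattice *)

(** The sites of [X v] form the branch set of the vertex [v]: the branch sets
are disjoint and connected, and branch sets of adjacent vertices are joined by
a bond. *)
Section LatticeMinor.
Variables (V : finType) (E : {set {set V}}) (U : {set V}) (m : nat).
Variables (X : V -> pred site) (base : V -> site).
Hypothesis U_n0 : U != set0.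
Hypothesis E_U : forall f, f \in E -> #|f| = 2%N /\ f \subset U.
Hypothesis X_range :
  forall v x, X v x -> (0 < x.1 < m.+1)%N && (0 < x.2 < m.+1)%N.
Hypothesis X_disj : forall u v x, X u x -> X v x -> u = v.
Hypothesis X_base : forall v, X v (base v).
Hypothesis X_linked : forall v x, X v x -> linked (X v) (base v) x.
Hypothesis X_adj :
  forall u v, [set u; v] \in E -> exists x y, [/\ X u x, X v y & site_adj x y].

Let cell := ('I_m.+1 * 'I_m.+1)%type.
Let lk (l : bool * cell) : bond := (l.1, of_ord l.2).

(** The bonds to be contracted. *)
Let K (l : bond) : bool := [exists v, X v (end1 l) && X v (end2 l)].

Lemma crossing_bonds : exists g : {set V} -> bool * cell,
  forall f, f \in E -> exists u v, [/\ f = [set u; v], u != v,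
     X u (end1 (lk (g f))) & X v (end2 (lk (g f)))].
Proof.
apply: (@fin_all_exists {set V} (fun _ => bool * cell)%type
  (fun f l => f \in E -> exists u v, [/\ f = [set u; v], u != v,
     X u (end1 (lk l)) & X v (end2 (lk l))])) => f.
have [fE|_] := boolP (f \in E); last by exists (true, (ord0, ord0)).
have [/eqP/cards2P[u [v [uv fuv]]] _] := E_U fE.
rewrite fuv in fE; have [x [y [Xx Xy [l xy]]]] := X_adj fE.
have [u' [v' [fuv' uv' Xu Xv]]] : exists u' v', [/\ f = [set u'; v'], u' != v',
   X u' (end1 l) & X v' (end2 l)].
  case: xy => -[xE yE]; rewrite -xE -yE; first by exists u, v.
  by exists v, u; rewrite setUC eq_sym.
exists (l.1, (inord l.2.1, inord l.2.2)) => _; exists u', v'.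
have /andP[/andP[_ lt1] /andP[_ lt2]] := X_range Xu.
rewrite (_ : lk _ = l) //; rewrite /lk /of_ord /= !inordK //.
by case: (l) => ? [? ?].
Qed.

Variable g : {set V} -> bool * cell.
Hypothesis gP : forall f, f \in E -> exists u v, [/\ f = [set u; v], u != v,
     X u (end1 (lk (g f))) & X v (end2 (lk (g f)))].

(** The bonds to be contracted and those chosen for the edges; all others are
deleted. *)
Let kept (l : bond) := K l || [exists f in E, lk (g f) == l].

Lemma X_eq u v x : X u x -> X v x = (v == u).
Proof.
by move=> Xu; apply/idP/eqP => [Xv|->//]; apply: X_disj Xv Xu.
Qed.

Lemma crossing_ends f v : f \in E ->
  (X v (end1 (lk (g f))))%:R + (X v (end2 (lk (g f))))%:R =
  (v \in f)%:R :> 'F_2.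
Proof.
move=> /gP[u [w [-> uw Xu Xw]]]; rewrite (X_eq v Xu) (X_eq v Xw) !inE.
case: (eqVneq v u) => [->|_]; rewrite ?add0r //.
by rewrite (negPf uw) addr0.
Qed.

Lemma crossing_inj : {in E &, injective (fun f => lk (g f))}.
Proof.
move=> f f' /gP[u [v [-> _ Xu Xv]]] /gP[u' [v' [-> _ Xu' Xv']]] gg.
by rewrite gg in Xu Xv; rewrite (X_disj Xu Xu') (X_disj Xv Xv').
Qed.

Lemma crossing_not_inner f : f \in E -> ~~ K (lk (g f)).
Proof.
move=> /gP[u [v [_ uv Xu Xv]]]; apply/existsP => -[w /andP[Xw1 Xw2]].
by rewrite -(X_disj Xw1 Xu) (X_disj Xw2 Xv) eqxx in uv.
Qed.

(** The edge [uv] lifts to a lattice path from [base u] to [base v] through the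
bond chosen for it; the rest of the path stays inside the two branch sets. *)
Lemma edge_chains : exists q : {set V} -> bond -> 'F_2, forall f, f \in E ->
  [/\ forall f', f' \in E -> q f (lk (g f')) = (f == f')%:R,
      forall l, q f l != 0 -> kept l &
      forall x, (0 < x.1)%N -> (0 < x.2)%N ->
        divergence (q f) x = \sum_(v in f) (x == base v)%:R].
Proof.
apply: (@fin_all_exists {set V} (fun _ => bond -> 'F_2)
  (fun f q => f \in E ->
  [/\ forall f', f' \in E -> q (lk (g f')) = (f == f')%:R,
      forall l, q l != 0 -> kept l &
      forall x, (0 < x.1)%N -> (0 < x.2)%N ->
        divergence q x = \sum_(v in f) (x == base v)%:R])) => f.
have [fE|_] := boolP (f \in E); last by exists (fun=> 0).
have [u [v [fuv uv Xu Xv]]] := gP fE.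
have X_gt0 w x : X w x -> (0 < x.1)%N /\ (0 < x.2)%N.
  by move=> /X_range/andP[/andP[-> _] /andP[-> _]].
have [qu [qu_supp qu_div]] := linked_chain (@X_gt0 u) (X_base u) (X_linked Xu).
have [qv [qv_supp qv_div]] := linked_chain (@X_gt0 v) (X_base v) (X_linked Xv).
have inner w q : (forall l : bond, q l != 0 -> X w (end1 l) && X w (end2 l)) ->
    forall l, ~~ K l -> q l = 0 :> 'F_2.
  move=> q_supp l; apply: contraNeq => /q_supp Xl.
  by apply/existsP; exists w.
exists (fun l => (l == lk (g f))%:R + (qu l + qv l)) => _; split.
- move=> f' f'E; have gK := crossing_not_inner f'E.
  rewrite (inner u) // (inner v) // !addr0.
  by rewrite (inj_in_eq crossing_inj) // eq_sym.
- move=> l; apply: contraNT => /norP[lK lg].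
  rewrite (inner u) // (inner v) // !addr0.
  have [lE|_] := eqVneq l (lk (g f)); last by [].
  by case/negP: lg; apply/existsP; exists f; rewrite fE lE eqxx.
- move=> x x1 x2; have [l1 l2] := X_gt0 _ _ Xu.
  transitivity (divergence (fun l => (l == lk (g f))%:R) x +
                (divergence qu x + divergence qv x)).
    by rewrite /divergence; ring.
  rewrite qu_div // qv_div // divergence_bond //.
  rewrite fuv big_setU1 ?inE //= big_set1.
  have cancel2 (a b c d : 'F_2) : a + b + (c + a + (d + b)) = c + d.
    have -> : a + b + (c + a + (d + b)) = c + d + ((a + a) + (b + b)) by ring.
    by rewrite !addxx_F2 !addr0.
  exact: cancel2.
Qed.

Let lower (i : 'I_m.+1) : 'I_m.+1 := inord i.-1.

Let c1 (l : bool * cell) : cell := l.2.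
Let c2 (l : bool * cell) : cell :=
  if l.1 then (l.2.1, lower l.2.2) else (lower l.2.1, l.2.2).

(** Deleting a bond merges the two cells on its sides. *)
Let side (c c' : cell) := [exists l, ~~ kept (lk l) &&
  ((c == c1 l) && (c' == c2 l) || (c' == c1 l) && (c == c2 l))].

Lemma side_sym : connect_sym side.
Proof.
by apply: sym_connect_sym => c c'; apply: eq_existsb => l; rewrite orbC.
Qed.

Let face := fingraph.root side.

Lemma face_eq l : ~~ kept (lk l) -> face (c1 l) = face (c2 l).
Proof.
move=> lK; apply/(fingraph.rootP side_sym)/connect1/existsP; exists l.
by rewrite lK !eqxx.
Qed.

Let lowerE (i : 'I_m.+1) : lower i = i.-1 :> nat.
Proof. by rewrite inordK // (leq_ltn_trans (leq_pred i)). Qed.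

Let c1E l : of_ord (c1 l) = cell1 (lk l).
Proof. by []. Qed.

Let c2E l : of_ord (c2 l) = cell2 (lk l).
Proof. by case: l => -[] [i j]; rewrite /of_ord /c2 /cell2 /= lowerE. Qed.

Let bnd (c : cell) (f : {set V}) : 'F_2 :=
  (face (c1 (g f)) == c)%:R + (face (c2 (g f)) == c)%:R.

(** A cycle lifts to a lattice cycle, which is a sum of cells by
[discrete_jordan]. The coefficients of these cells agree on both sides of any
bond off the lattice cycle, hence they are constant on each face. *)
Lemma faces_generate (z : {set V} -> 'F_2) :
    (forall v, \sum_(f in E) z f * (v \in f)%:R = 0) ->
  exists W : cell -> 'F_2, {in E, forall f, z f = \sum_c W c * bnd c f}.
Proof.
move=> z_even; have [q qP] := edge_chains.
pose zz l := \sum_(f in E) z f * q f l.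
have zz_kept l : zz l != 0 -> kept l.
  apply: contraNT => lK; apply/eqP/big1 => f fE.
  have [_ q_supp _] := qP f fE.
  suff -> : q f l = 0 by rewrite mulr0.
  by apply/eqP; apply: contraNT lK => /q_supp.
have kept_gt0 l : kept l -> (0 < l.2.1)%N && (0 < l.2.2)%N.
  case/orP => [/existsP[v /andP[/X_range /andP[/andP[-> _] /andP[-> _]]]]//|].
  case/exists_inP => f /gP[u [v [_ _ /X_range Xu _]]] /eqP<-.
  by case/andP: Xu => /andP[-> _] /andP[-> _].
have [l||W WP] := @discrete_jordan zz; first by move=> /zz_kept/kept_gt0.
  move=> x x1 x2; rewrite divergence_sum.
  transitivity (\sum_(f in E) \sum_v z f * (v \in f)%:R * (x == base v)%:R).
    apply: eq_bigr => f fE; have [_ _ ->] := qP f fE => //.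
    rewrite big_distrr [LHS]big_mkcond /=; apply: eq_bigr => v _.
    by case: (v \in f); rewrite ?mulr1 // mulr0 mul0r.
  rewrite exchange_big big1 // => v _.
  by rewrite -mulr_suml z_even mul0r.
have W_side c c' : side c c' -> W (of_ord c) = W (of_ord c').
  case/existsP => l /andP[lK ll].
  have zl : zz (lk l) = 0 by apply/eqP; apply: contraNT lK => /zz_kept.
  move: (WP (lk l)); rewrite zl -c1E -c2E => /esym/eqP.
  rewrite addr_eq0 (oppr_pchar2 (pchar_Fp _)) // => /eqP Wl.
  by case/orP: ll => /andP[/eqP-> /eqP->].
have W_face c : W (of_ord (face c)) = W (of_ord c).
  rewrite /face; have /connectP[p p_path ->] := connect_root side c.
  elim: p c p_path => //= c' p IHp c /andP[cc' p_path].
  by rewrite IHp // (W_side _ _ cc').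
exists (fun c => W (of_ord c)) => f fE.
transitivity (zz (lk (g f))).
  rewrite /zz (bigD1 f) //= big1 ?addr0 => [|f' /andP[f'E f'f]].
    by have [-> // _ _] := qP f fE; rewrite eqxx mulr1.
  by have [-> // _ _] := qP f' f'E; rewrite (negPf f'f) mulr0.
rewrite WP -c1E -c2E -W_face -[in RHS]/(c2 _).
under eq_bigr do rewrite mulrDr.
rewrite big_split /=; congr (_ + _).
  rewrite (bigD1 (face (c1 (g f)))) //= eqxx mulr1 big1 ?addr0 // => c cc.
  by rewrite eq_sym (negPf cc) mulr0.
rewrite (bigD1 (face (c2 (g f)))) //= eqxx mulr1 big1 ?addr0 ?W_face // => c cc.
by rewrite eq_sym (negPf cc) mulr0.
Qed.

(** The boundary [chi] of a union of cells has no divergence. Summed over the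
branch set of [v], this leaves the bonds with exactly one end in that set.
Among these, [chi] vanishes on the deleted bonds, which do not separate faces,
so only the bonds chosen for the edges at [v] remain. *)
Lemma face_boundary_even (c : cell) (v : V) :
  \sum_(f in E) bnd c f * (v \in f)%:R = 0.
Proof.
pose phi (x : site) : 'F_2 := (face (inord x.1, inord x.2) == c)%:R.
pose chi l := phi (cell1 l) + phi (cell2 l).
have phiE c' : phi (of_ord c') = (face c' == c)%:R.
  by case: c' => i j; rewrite /phi /= !inord_val.
have chiE l : chi (lk l) = (face (c1 l) == c)%:R + (face (c2 l) == c)%:R.
  by rewrite /chi -c1E -c2E !phiE.
have chi_div x : (0 < x.1)%N -> (0 < x.2)%N -> divergence chi x = 0.
  case: x => -[|i] [|j] // _ _; rewrite /divergence /chi /cell1 /cell2 /=.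
  set a := phi _; set b := phi _; set d := phi _; set h := phi (i, j).
  have -> : a + b + (d + h) + (a + d + (b + h)) =
    (a + a) + (b + b) + ((d + d) + (h + h)) by ring.
  by rewrite !addxx_F2.
have := sum_flux chi (@X_range v); rewrite [RHS]big1 => [|x _]; last first.
  have [/X_range/andP[/andP[x1 _] /andP[x2 _]]|_] := boolP (X v _).
    by rewrite chi_div // mulr0.
  by rewrite mul0r.
move=> flux; rewrite -[RHS]flux.
pose Phi (l : bond) : 'F_2 := chi l * ((X v (end1 l))%:R + (X v (end2 l))%:R).
rewrite -[RHS]/(\sum_l Phi (lk l)).
have g_inj : {in E &, injective g}.
  by move=> f f' fE f'E gg; apply: crossing_inj; rewrite ?gg.
rewrite (bigID (mem (g @: E))) /= [X in _ + X]big1 ?addr0 => [|l lg].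
  rewrite big_imset //=; apply: eq_bigr => f fE.
  by rewrite /Phi crossing_ends // chiE.
rewrite /Phi; have [/existsP[w /andP[Xw1 Xw2]]|lK] := boolP (K (lk l)).
  by rewrite (X_eq v Xw1) (X_eq v Xw2) addxx_F2 mulr0.
rewrite chiE face_eq ?addxx_F2 ?mul0r // /kept (negPf lK) /=.
apply: contra lg => /exists_inP[f fE /eqP lkg].
apply/imsetP; exists f => //; apply/esym.
case: (g f) lkg => b [i j].
case: l {lK} => b' [i' j'] [-> /val_inj-> /val_inj->].
by [].
Qed.

Lemma crossing_minor_bound :
    (forall s, (2 < size s)%N -> ucycleb (fun v w => [set v; w] \in E) s ->
       (6 <= size s)%N) ->
  (2 * #|E| < 3 * #|U|)%N.
Proof.
move=> E_girth.
have sub_inc (z : {set V} -> 'F_2) v : v \notin U ->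
    \sum_(f in E) z f * (v \in f)%:R = 0.
  move=> vU; apply: big1 => f /E_U[_ /subsetP fU].
  by case: (boolP (v \in f)) => [/fU|_]; rewrite ?(negPf vU) ?mulr0.
apply: (@two_fold_generated_bound _ _ _ E U (fun f v => (v \in f)%:R) bnd).
- exact: U_n0.
- move=> f fE; have [f2 fU] := E_U fE.
  transitivity (#|f|%:R : 'F_2); last first.
    by rewrite f2 -[2%N]/(1 + 1)%N natrD addxx_F2.
  rewrite -sum1_card natr_sum [LHS]big_mkcond [RHS]big_mkcond /=.
  apply: eq_bigr => v _; case: (boolP (v \in f)) => [/(subsetP fU)->//|_].
  by case: (v \in U).
- move=> z z_even; apply: faces_generate => v.
  by have [/z_even|/sub_inc] := boolP (v \in U).
- move=> f fE.
  apply: leq_trans (_ : #|[set face (c1 (g f)); face (c2 (g f))]| <= _)%N.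
    apply/subset_leq_card/subsetP => c; rewrite !inE; apply: contraNT.
    rewrite negb_or /bnd => /andP[]; rewrite ![c == _]eq_sym.
    by move=> /negPf-> /negPf->; rewrite addr0.
  by rewrite cards2; case: eqP.
- move=> c /exists_inP[f fE fc].
  set zc := [set f in E | bnd c f != 0].
  have zcE h : h \in zc -> h \in E by rewrite inE => /andP[].
  have zc2 h : h \in zc -> #|h| = 2%N by move=> /zcE/E_U[].
  apply: (even_edge_set_large zc2).
  + by apply/set0Pn; exists f; rewrite inE fE.
  + move=> v; have := face_boundary_even c v.
    rewrite (_ : \sum_(_ in _) _ = #|[set h in zc | v \in h]|%:R).
      by rewrite natr_F2; case: odd => // /eqP; rewrite oner_eq0.
    rewrite -sum1_card natr_sum [LHS]big_mkcond [RHS]big_mkcond /=.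
    apply: eq_bigr => h _; rewrite !inE.
    case: (h \in E) => //=; have [->|/F2_neq0->] := eqVneq (bnd c h) 0.
      by rewrite mul0r.
    by rewrite mul1r; case: (v \in h).
  + move=> s s3 /andP[s_cyc s_uniq]; apply: E_girth => //.
    apply/andP; split => //; apply: sub_cycle s_cyc => v w /zcE.
    by [].
Qed.

End LatticeMinor.

(** The count of [two_fold_generated_bound] for the faces of the minor: they
generate the cycle space by [faces_generate], an edge is on the boundary of at
most the two faces beside the bond chosen for it, and a nonempty face boundary
is an even edge set, so that it contains a cycle. *)
Lemma lattice_minor_bound (V : finType) (E : {set {set V}}) (U : {set V})
    (m : nat) (X : V -> pred site) (base : V -> site) :
    U != set0 ->
    (forall f, f \in E -> #|f| = 2%N /\ f \subset U) ->
    (forall v x, X v x -> (0 < x.1 < m.+1)%N && (0 < x.2 < m.+1)%N) ->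
    (forall u v x, X u x -> X v x -> u = v) ->
    (forall v, X v (base v)) ->
    (forall v x, X v x -> linked (X v) (base v) x) ->
    (forall u v, [set u; v] \in E ->
       exists x y, [/\ X u x, X v y & site_adj x y]) ->
    (forall s, (2 < size s)%N -> ucycleb (fun v w => [set v; w] \in E) s ->
       (6 <= size s)%N) ->
  (2 * #|E| < 3 * #|U|)%N.
Proof.
move=> U_n0 E_U X_range X_disj X_base X_linked X_adj.
have [g gP] := crossing_bonds E_U X_range X_adj.
exact: (crossing_minor_bound U_n0 E_U X_range X_disj X_base X_linked gP).
Qed.

(** * Connected sets of lattice sites *)

Lemma site_adjC x y : site_adj x y -> site_adj y x.
Proof. by case=> l [[-> ->]|[-> ->]]; exists l; [right|left]. Qed.

Lemma linked_trans (Y : site -> Prop) x y z :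
  linked Y x y -> linked Y y z -> linked Y x z.
Proof.
by move=> xy; elim=> [//|u v _ xu uv Yv]; apply: linked_step xu uv Yv.
Qed.

Lemma linked_sub (Y Z : site -> Prop) x y :
  (forall u, Y u -> Z u) -> linked Y x y -> linked Z x y.
Proof.
move=> YZ; elim=> [|u v _ xu uv Yv]; first exact: linked_refl.
exact: linked_step xu uv (YZ _ Yv).
Qed.

Lemma linked_in (Y : site -> Prop) x y : Y x -> linked Y x y -> Y y.
Proof. by move=> Yx; case. Qed.

Lemma linked_sym (Y : site -> Prop) x y : Y x -> linked Y x y -> linked Y y x.
Proof.
move=> Yx; elim=> [|u v xu ux uv Yv]; first exact: linked_refl.
apply: linked_trans ux; apply: linked_step (linked_refl _ _) (site_adjC uv) _.
exact: linked_in xu.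
Qed.

(** Nearness describes blocks of three by three sites. The pixels along a curve
may be diagonal neighbors, which no bond joins; the blocks around them overlap,
so their union is connected. *)
Definition near1 (i j : nat) := (i <= j.+1)%N && (j <= i.+1)%N.
Definition near_site (x y : site) := near1 x.1 y.1 && near1 x.2 y.2.

Lemma near1xx i : near1 i i.
Proof. by rewrite /near1 leqnSn. Qed.

Lemma near_sitexx x : near_site x x.
Proof. by rewrite /near_site !near1xx. Qed.

Lemma near_siteC x y : near_site x y = near_site y x.
Proof. by rewrite /near_site /near1 [X in X && _]andbC [X in _ && X]andbC. Qed.

Lemma linked_near p x :
  near_site x p -> linked (near_site^~ p) p x.
Proof.
case: p x => p1 p2 [x1 x2] /andP[/= n1 n2].
have step1 : linked (near_site^~ (p1, p2)) (p1, p2) (x1, p2).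
  have [->|->|->] : [\/ x1 = p1, x1 = p1.+1 | p1 = x1.+1].
    move: n1; rewrite /near1.
    have [->|] := eqVneq x1 p1; first by constructor 1.
    by have [|] := eqVneq x1 p1.+1; [constructor 2|constructor 3; lia].
  - exact: linked_refl.
  - apply: linked_step (linked_refl _ _) _ _.
      by exists (true, (p1, p2)); left.
    by rewrite /near_site /near1 /=; lia.
  - apply: linked_step (linked_refl _ _) _ _.
      by exists (true, (x1, p2)); right.
    by rewrite /near_site /near1 /=; lia.
apply: linked_trans step1 _.
have [->|xp|px] : [\/ x2 = p2, x2 = p2.+1 | p2 = x2.+1].
  move: n2; rewrite /near1; have [->|] := eqVneq x2 p2; first by constructor 1.
  by have [|] := eqVneq x2 p2.+1; [constructor 2|constructor 3; lia].
- exact: linked_refl.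
- apply: linked_step (linked_refl _ _) _ _.
    by exists (false, (x1, p2)); left; rewrite xp.
  by rewrite /near_site /= n1.
- apply: linked_step (linked_refl _ _) _ _.
    by exists (false, (x1, x2)); right; rewrite px.
  by rewrite /near_site /= n1.
Qed.

(** * From plane drawings to lattice minors *)

Section PlaneDrawings.
Local Open Scope classical_set_scope.
Import boolp classical_sets.

Section Pixels.
Variables (R : realType) (M eps : R).
Hypothesis eps_gt0 : 0 < eps.

(** The shift by two leaves room for the block around a pixel at positive
coordinates. *)
Definition cell_of (r : R) : nat := (Num.truncn ((r + M) / eps)).+2.

Definition pixel (x : R * R) : site := (cell_of x.1, cell_of x.2).

Definition thicken (B : set (R * R)) (x : site) : Prop :=
  exists2 b, B b & near_site x (pixel b).

Lemma cell_of_near (r s : R) : `|r - s| < eps -> near1 (cell_of r) (cell_of s).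
Proof.
suff le1 (u v : R) : `|u - v| < eps -> (cell_of u <= (cell_of v).+1)%N.
  by move=> rs; rewrite /near1 !le1 // distrC.
move=> uv; rewrite /cell_of !ltnS truncn_le_nat.
have := truncnS_gt ((v + M) / eps); rewrite !ltr_pdivrMr // => lt_v.
apply: (@lt_trans _ _ (v + M + eps)).
  by move: uv; rewrite ltr_norml => /andP[_]; lra.
by rewrite -[X in _ < X%:R * _]addn1 natrD mulrDl mul1r ltrD2r.
Qed.

Lemma cell_of_sep (r s : R) (i : nat) : - M <= r -> - M <= s ->
  near1 i (cell_of r) -> near1 i (cell_of s) -> `|r - s| < 3 * eps.
Proof.
suff lt3 (u v : R) : - M <= v -> - M <= u ->
    near1 i (cell_of u) -> near1 i (cell_of v) -> u - v < 3 * eps.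
  move=> r0 s0 ir is_; rewrite ltr_norml; have := lt3 _ _ s0 r0 ir is_.
  by have := lt3 _ _ r0 s0 is_ ir; lra.
move=> v0 u0 /andP[_ iu] /andP[iv _].
have le2 : (cell_of u <= (cell_of v).+2)%N by lia.
have /truncn_itv/andP[] : 0 <= (v + M) / eps.
  by apply: divr_ge0; [rewrite -lerBlDr sub0r|exact: ltW].
rewrite ler_pdivlMr // => v_le _.
have := truncnS_gt ((u + M) / eps); rewrite ltr_pdivrMr // => u_lt.
have : (Num.truncn ((u + M) / eps)).+1%:R <=
    (Num.truncn ((v + M) / eps))%:R + 3 :> R.
  by rewrite -(natrD _ _ 3) ler_nat; move: le2; rewrite /cell_of; lia.
rewrite -(ler_pM2r eps_gt0) [X in _ <= X]mulrDl; lra.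
Qed.

Lemma pixel_near (x y : R * R) :
  `|x - y| < eps -> near_site (pixel x) (pixel y).
Proof.
rewrite prod_normE /= gt_max => /andP[? ?].
by rewrite /near_site !cell_of_near.
Qed.

Lemma pixel_sep (x y : R * R) (a : site) : `|x| <= M -> `|y| <= M ->
  near_site a (pixel x) -> near_site a (pixel y) -> `|x - y| < 3 * eps.
Proof.
rewrite !prod_normE /= !ge_max => /andP[x1 x2] /andP[y1 y2].
move: x1 x2 y1 y2; rewrite !ler_norml.
move=> /andP[? _] /andP[? _] /andP[? _] /andP[? _].
move=> /andP[? ?] /andP[? ?]; rewrite gt_max.
by rewrite (@cell_of_sep _ _ a.1) // (@cell_of_sep _ _ a.2).
Qed.

Lemma pixel_range (x : R * R) (a : site) : `|x| <= M -> near_site a (pixel x) ->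
  let m := (Num.truncn ((M + M) / eps) + 3)%N in
  (0 < a.1 < m.+1)%N && (0 < a.2 < m.+1)%N.
Proof.
have range (r : R) i : r <= M -> near1 i (cell_of r) ->
    (0 < i < (Num.truncn ((M + M) / eps) + 3).+1)%N.
  move=> rM.
  have : (Num.truncn ((r + M) / eps) <= Num.truncn ((M + M) / eps))%N.
    by apply: le_truncn; rewrite ler_pM2r ?invr_gt0 // lerD2r.
  by rewrite /near1 /cell_of; lia.
rewrite prod_normE /= ge_max => /andP[x1 x2] /andP[a1 a2].
by rewrite (range x.1) ?(range x.2) //; apply: le_trans (ler_norm _) _.
Qed.

Lemma thicken_pixel (B : set (R * R)) b : B b -> thicken B (pixel b).
Proof. by move=> Bb; exists b => //; apply: near_sitexx. Qed.

Lemma thicken_linked (B : set (R * R)) b x : B b -> near_site x (pixel b) ->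
  linked (thicken B) (pixel b) x.
Proof. by move=> Bb xb; apply: linked_sub (linked_near xb) => u; exists b. Qed.

(** Points at distance less than [eps] have near pixels, so being linked to [g
s] is a locally constant property of the parameter, and the segment is
connected. *)
Lemma curve_linked (g : R -> R * R) (a b s t : R) :
    {within `[a, b], continuous g} -> `[a, b] s -> `[a, b] t ->
  linked (thicken (g @` `[a, b])) (pixel (g s)) (pixel (g t)).
Proof.
move=> g_cont sab tab; set Y := thicken _.
have Ypix r : `[a, b] r -> Y (pixel (g r)).
  by move=> rab; apply: thicken_pixel; exists r.
have close_linked r r' : `[a, b] r -> `[a, b] r' -> `|g r - g r'| < eps ->
    linked Y (pixel (g r)) (pixel (g r')).
  move=> rab r'ab rr'; apply: thicken_linked; first by exists r.
  by rewrite near_siteC pixel_near.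
have near_g r : `[a, b] r -> exists2 U, open_nbhs r U &
    forall r', `[a, b] r' -> U r' -> `|g r - g r'| < eps.
  move=> rab; move/subspace_continuousP : g_cont.
  move=> /(_ r rab)/cvgrPdist_lt/(_ _ eps_gt0).
  rewrite near_withinE nbhsE => -[U rU gU].
  by exists U => // r' r'ab r'U; apply: gU.
pose B := [set r | `[a, b] r /\ linked Y (pixel (g s)) (pixel (g r))].
suff : B = `[a, b] by move=> BE; have := tab; rewrite -BE => -[].
have linkedC r r' : `[a, b] r -> linked Y (pixel (g r)) (pixel (g r')) ->
    linked Y (pixel (g r')) (pixel (g r)).
  by move=> rab; apply: linked_sym; apply: Ypix.
pose cover (P : set R) := \bigcup_(U in [set U | open U /\ exists2 r,
  P r & forall r', `[a, b] r' -> U r' -> `|g r - g r'| < eps]) U.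
have cover_open P : open (cover P) by apply: bigcup_open => U [].
have in_cover (P : set R) r : `[a, b] r -> P r -> cover P r.
  move=> rab Pr; have [U [Uo Ur] gU] := near_g r rab.
  by exists U => //; split=> //; exists r.
apply: (segment_connected (a := a) (b := b)).
- by exists s; split => //; apply: linked_refl.
- exists (cover B) => //; apply/seteqP; split => r /=.
    by move=> Br; have [rab _] := Br; split => //; apply: in_cover.
  move=> [rab [U [_ [r0 [r0ab sr0] r0U]] Ur]]; split => //.
  by apply: linked_trans sr0 (close_linked _ _ r0ab rab _); apply: r0U.
- exists (~` cover (`[a, b] `\` B)); first exact: open_closedC.
  apply/seteqP; split => r /=.
    move=> [rab sr]; split => // -[U [_ [r0 [r0ab r0B] r0U]] Ur].
    apply: r0B; split => //; apply: linked_trans sr _.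
    by apply: linkedC => //; apply: close_linked => //; apply: r0U.
  move=> [rab rC]; apply: contrapT => rB; apply: rC.
  by apply: in_cover.
Qed.

End Pixels.

Lemma compact_disjoint_dist (R : realType) (A B : set (R * R)) :
    compact A -> compact B -> A `&` B = set0 ->
  exists2 eta : R, 0 < eta & forall x y, A x -> B y -> eta <= `|x - y|.
Proof.
move=> A_cpt B_cpt AB0.
have [[z [zA zB]]|AB] := pselect ((A `*` B) !=set0); last first.
  by exists 1 => // x y Ax By; case: AB; exists (x, y).
pose dist (w : (R * R) * (R * R)) : R := `|w.1 - w.2|.
have dist_cont : {within A `*` B, continuous dist}.
  apply: continuous_subspaceT => w; apply: cvg_norm.
  by apply: cvgB; [exact: cvg_fst|exact: cvg_snd].
have [|w wAB w_min] := compact_EVT_min _ (compact_setX A_cpt B_cpt) dist_cont.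
  by exists z.
move: wAB; rewrite inE => -[wA wB].
exists (dist w) => [|x y Ax By]; last by apply: (w_min (x, y)); rewrite inE.
rewrite normr_gt0 subr_eq0; apply/eqP => w12.
have : (A `&` B) w.1 by split; rewrite // w12.
by rewrite AB0.
Qed.

(** The constant 3 fits [pixel_sep]: on a grid of mesh [eps], no site is near
pixels of two disjoint members of the family. *)
Lemma compact_family_scale (R : realType) (Q : finType) (P : Q -> set (R * R)) :
    (forall q, compact (P q)) ->
  exists M eps : R, [/\ 0 < eps, forall q x, P q x -> `|x| <= M &
    forall q q', P q `&` P q' = set0 ->
      forall x y, P q x -> P q' y -> 3 * eps <= `|x - y|].
Proof.
move=> P_cpt.
have [M MP] : exists M : R, forall q x, P q x -> `|x| <= M.
  have : \forall M \near +oo, forall q x, P q x -> `|x| <= M.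
    by apply: filter_forall => q; exact: (compact_bounded (P_cpt q)).
  move=> /(@filter_ex _ _ (@proper_pinfty_nbhs R))[M MP].
  by exists M.
have [eta eta_gt0 etaP] : exists2 eta : R, 0 < eta & forall qq : Q * Q,
    P qq.1 `&` P qq.2 = set0 ->
    forall x y, P qq.1 x -> P qq.2 y -> eta <= `|x - y|.
  have : \forall eta \near (0 : R)^'+, 0 < eta /\ forall qq : Q * Q,
      P qq.1 `&` P qq.2 = set0 ->
      forall x y, P qq.1 x -> P qq.2 y -> eta <= `|x - y|.
    apply: filterI; first exact: nbhs_right_gt.
    apply: (@filter_forall _ (Q * Q)%type (fun qq eta =>
      P qq.1 `&` P qq.2 = set0 -> forall x y, P qq.1 x -> P qq.2 y ->
      eta <= `|x - y|) ((0 : R)^'+) _) => -[q q'].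
    have [PP|] := pselect (P q `&` P q' = set0); last by move=> ?; near=> e.
    have [eta eta_gt0 etaP] := compact_disjoint_dist (P_cpt q) (P_cpt q') PP.
    near=> e => _ x y Px Py; apply: le_trans (etaP x y Px Py).
    by near: e; apply: nbhs_right_le.
  by move=> /filter_ex[eta []]; exists eta.
exists M, (eta / 3); split => //; first by rewrite divr_gt0.
move=> q q' PP x y Px Py; rewrite mulrC divfK //.
exact: (etaP (q, q')).
Unshelve. all: by end_near.
Qed.

Section Drawing.
Variables (R : realType) (G : sgraph) (p : G -> R * R).
Variable A : {set G} -> set (R * R).
Hypothesis drawing : plane_drawing p A.

(** One of the two orientations of each edge is selected, so that each arc gets
a single parametrization and its thirds are well defined. *)
Definition oriented (d : G * G) :=
  adj d.1 d.2 && (enum_rank d.1 < enum_rank d.2)%N.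

Lemma adj_oriented (u v : G) : adj u v -> oriented (u, v) \/ oriented (v, u).
Proof.
move=> uv.
have [lt|lt|/val_inj/enum_rank_inj E] := ltngtP (enum_rank u) (enum_rank v).
- by left; rewrite /oriented /= uv.
- by right; rewrite /oriented /= adj_sym uv.
- by rewrite E adj_irrefl in uv.
Qed.

Lemma oriented_edge_inj d d' : oriented d -> oriented d' ->
  [set d.1; d.2]%SET = [set d'.1; d'.2]%SET -> d = d'.
Proof.
case: d d' => u v [u' v'] /andP[/= uv u_lt] /andP[/= uv' u'_lt] /setP E.
have := E u; have := E v; have := E u'; have := E v'.
rewrite !inE !eqxx !orbT /=.
move=> /orP[]/eqP ? /orP[]/eqP ? /esym/orP[]/eqP ? /esym/orP[]/eqP ?;
  subst => //.
all: try by rewrite ltnn in u_lt.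
all: try by rewrite ltnn in u'_lt.
by have := ltn_trans u_lt u'_lt; rewrite ltnn.
Qed.

Lemma arcs_param : exists g : G * G -> R -> R * R, forall d, oriented d ->
  [/\ {within `[0, 1], continuous (g d)}, {in `[0, 1] &, injective (g d)},
      g d 0 = p d.1, g d 1 = p d.2 & A [set d.1; d.2]%SET = g d @` `[0, 1]].
Proof.
have H (d : G * G) : exists g : R -> R * R, oriented d ->
  [/\ {within `[0, 1], continuous g}, {in `[0, 1] &, injective g},
      g 0 = p d.1, g 1 = p d.2 & A [set d.1; d.2]%SET = g @` `[0, 1]].
  have [/andP[d_adj _]|_] := boolP (oriented d); last by exists (fun=> 0).
  by have [_ /(_ _ _ d_adj)[[g gP] _ _]] := drawing; exists g.
by have [g gP] := choice H; exists g.
Qed.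

Variable g : G * G -> R -> R * R.
Hypothesis gP : forall d, oriented d ->
  [/\ {within `[0, 1], continuous (g d)}, {in `[0, 1] &, injective (g d)},
      g d 0 = p d.1, g d 1 = p d.2 & A [set d.1; d.2]%SET = g d @` `[0, 1]].

Definition at_end (d : G * G) (t : R) (w : G) :=
  (t = 0 /\ w = d.1) \/ (t = 1 /\ w = d.2).

Lemma arc_vertex d t w : oriented d -> `[0, 1] t -> g d t = p w -> at_end d t w.
Proof.
move=> dd t01 gw; have [p_inj dr] := drawing.
have [g_cont g_inj g0 g1 AE] := gP dd.
have [t0|t0] := eqVneq t 0.
  by left; split => //; apply: p_inj; rewrite -gw t0.
have [t1|t1] := eqVneq t 1.
  by right; split => //; apply: p_inj; rewrite -gw t1.
have /andP[d_adj _] := dd; have [_ no_vertex _] := dr _ _ d_adj.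
case: (no_vertex w).
rewrite AE; split; first by exists t.
have in0 : (0 : R) \in `[0, 1] by rewrite inE /= in_itv /= lexx ler01.
have in1 : (1 : R) \in `[0, 1] by rewrite inE /= in_itv /= lexx ler01.
rewrite -gw -g0 -g1 => -[] /(g_inj _ _ (mem_set t01)) E.
  by rewrite E ?eqxx in t0.
by rewrite E ?eqxx in t1.
Qed.

(** An interior point of an arc lies on no other arc, so a common point of two
arcs is an end of both, that is, a vertex. *)
Lemma arc_cross d d' s t :
  oriented d -> oriented d' -> `[0, 1] s -> `[0, 1] t -> g d s = g d' t ->
  (d = d' /\ s = t) \/ exists w, at_end d s w /\ at_end d' t w.
Proof.
have [p_inj dr] := drawing.
suff inner e e' r r' : oriented e -> oriented e' -> `[0, 1] r -> `[0, 1] r' ->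
    g e r = g e' r' -> e <> e' -> exists2 w, g e r = p w & at_end e r w.
  move=> dd dd' s01 t01 gg; have [dE|dE] := pselect (d = d').
    left; split => //; subst d'; have [_ g_inj _ _ _] := gP dd.
    by apply: g_inj gg; rewrite inE.
  right; have [w gw sw] := inner _ _ _ _ dd dd' s01 t01 gg dE.
  exists w; split => //; apply: arc_vertex => //; by rewrite -gg.
move=> ed ed' r01 r'01 gg ee'.
have [g_cont g_inj g0 g1 AE] := gP ed.
have [r0|r0] := eqVneq r 0; first by exists e.1; [rewrite r0|left].
have [r1|r1] := eqVneq r 1; first by exists e.2; [rewrite r1|right].
have /andP[e_adj _] := ed; have /andP[e'_adj _] := ed'.
have [_ _ /(_ [set e'.1; e'.2]%SET)] := dr _ _ e_adj.
have in_edges : [set e'.1; e'.2]%SET \in edges G.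
  by apply/imsetP; exists e' => //; rewrite inE.
move=> /(_ in_edges) disj.
have /disj : [set e'.1; e'.2]%SET != [set e.1; e.2]%SET.
  by apply/eqP => /(oriented_edge_inj ed' ed) E; apply: ee'.
move/seteqP => [/(_ (g e r)) no_common _]; case: no_common; split; last first.
  by have [_ _ _ _ ->] := gP ed'; rewrite gg; exists r'.
rewrite AE; split; first by exists r.
have in0 : (0 : R) \in `[0, 1] by rewrite inE /= in_itv /= lexx ler01.
have in1 : (1 : R) \in `[0, 1] by rewrite inE /= in_itv /= lexx ler01.
rewrite -g0 -g1 => -[] /(g_inj _ _ (mem_set r01)) E.
  by rewrite E ?eqxx in r0.
by rewrite E ?eqxx in r1.
Qed.

(** The outer thirds of an arc belong to its end vertices. Its middle third,
which contains neither of them, belongs to no vertex. *)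
Definition third (k : 'I_3) : set R := `[k%:R / 3, (k%:R + 1) / 3].

Definition piece (q : G + (G * G) * 'I_3) : set (R * R) :=
  match q with
  | inl v => [set p v]
  | inr (d, k) => if oriented d then g d @` third k else set0
  end.

Definition owns (v : G) (q : G + (G * G) * 'I_3) : bool :=
  match q with
  | inl w => w == v
  | inr (d, k) => oriented d &&
      ((d.1 == v) && (k == 0 :> nat)%N || (d.2 == v) && (k == 2 :> nat)%N)
  end.

Definition mid (d : G * G) : G + (G * G) * 'I_3 :=
  inr (d, Ordinal (isT : (1 < 3)%N)).

Lemma third01 k : third k `<=` `[0, 1].
Proof.
move=> t; rewrite /third /= !in_itv /=.
by case: k => -[|[|[|]]] //= _ /andP[]; lra.
Qed.

Lemma third_continuous d k : oriented d -> {within third k, continuous (g d)}.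
Proof.
by case/gP => gc _ _ _ _; apply: continuous_subspaceW gc; apply: third01.
Qed.

Lemma piece_compact q : compact (piece q).
Proof.
case: q => [v|[d k]] /=; first exact: compact_set1.
case: ifP => [dd|_]; last exact: compact0.
by apply: continuous_compact; [exact: third_continuous|exact: segment_compact].
Qed.

Lemma owns_at v d k t w :
  owns v (inr (d, k)) -> third k t -> at_end d t w -> w = v.
Proof.
rewrite /third /= in_itv /=.
move=> /andP[_ /orP[]] /andP[/eqP <- /eqP->] /andP[lo hi].
  by case=> -[tE ->] //; exfalso; move: hi; rewrite tE; lra.
by case=> -[tE ->] //; exfalso; move: lo; rewrite tE; lra.
Qed.

Lemma mid_at d t w : third (Ordinal (isT : (1 < 3)%N)) t -> ~ at_end d t w.
Proof.
rewrite /third /= in_itv /= => /andP[lo hi].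
by case=> -[tE _]; move: lo hi; rewrite tE; lra.
Qed.

Lemma owns_disjoint u v q q' : owns u q -> owns v q' -> u != v ->
  piece q `&` piece q' = set0.
Proof.
move=> uq vq' uv; apply/seteqP; split => // x [].
have [p_inj _] := drawing.
case: q q' uq vq' => [w|[d k]] [w'|[d' k']].
- by move=> /eqP-> /eqP-> -> /p_inj E; rewrite E eqxx in uv.
- move=> /eqP-> vq' ->; have /andP[dd' _] := vq'.
  rewrite /piece dd' => -[t tk gt].
  have := owns_at vq' tk (arc_vertex dd' (third01 tk) gt) => E.
  by rewrite E eqxx in uv.
- move=> uq /eqP-> + xE; have /andP[dd _] := uq.
  rewrite /piece dd => -[t tk gt].
  have := owns_at uq tk (arc_vertex dd (third01 tk) (etrans gt xE)) => E.
  by rewrite E eqxx in uv.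
- move=> uq vq'; have /andP[dd uk] := uq; have /andP[dd' vk'] := vq'.
  rewrite /piece dd dd' => -[s sk gs] [t tk' gt].
  have [[dE st]|[w [ws wt]]] :=
    arc_cross dd dd' (third01 sk) (third01 tk') (etrans gs (esym gt)).
    subst d' t; move: sk tk'.
    rewrite /third /= !in_itv /= => /andP[lo hi] /andP[lo' hi'].
    case/orP: uk => /andP[/eqP uE /eqP kE];
      case/orP: vk' => /andP[/eqP vE /eqP kE'].
    + by rewrite -uE -vE eqxx in uv.
    + by move: hi lo'; rewrite kE kE'; lra.
    + by move: lo hi'; rewrite kE kE'; lra.
    + by rewrite -uE -vE eqxx in uv.
  by rewrite -(owns_at uq sk ws) -(owns_at vq' tk' wt) eqxx in uv.
Qed.

Lemma owns_mid_disjoint w q d :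
  owns w q -> oriented d -> w != d.1 -> w != d.2 ->
  piece q `&` piece (mid d) = set0.
Proof.
move=> wq dd w1 w2; apply/seteqP; split => // x [+ +].
rewrite /piece /= dd => + [t tk gt].
case: q wq => [v|[d' k]].
  move=> _ xE; apply: (mid_at tk).
  exact: arc_vertex dd (third01 tk) (etrans gt xE).
move=> /andP[dd' wk]; rewrite dd' => -[s sk gs].
have [[dE _]|[v [_ vt]]] :=
  arc_cross dd' dd (third01 sk) (third01 tk) (etrans gs (esym gt)).
  by subst d'; case/orP: wk => /andP[/eqP wE _]; rewrite wE eqxx in w1 w2.
exact: mid_at tk vt.
Qed.

Lemma mid_disjoint d d' : oriented d -> oriented d' -> d <> d' ->
  piece (mid d) `&` piece (mid d') = set0.
Proof.
move=> dd dd' ne; apply/seteqP; split => // x [].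
rewrite /piece /= dd dd' => -[s sk gs] [t tk gt].
have [[dE _]|[v [_ vt]]] :=
  arc_cross dd dd' (third01 sk) (third01 tk) (etrans gs (esym gt)).
  exact: ne.
exact: mid_at tk vt.
Qed.

Section Model.
Variables (M eps : R).
Hypothesis eps_gt0 : 0 < eps.
Hypothesis piece_M : forall q x, piece q x -> `|x| <= M.
Hypothesis piece_sep : forall q q', piece q `&` piece q' = set0 ->
  forall x y, piece q x -> piece q' y -> 3 * eps <= `|x - y|.

Definition hat q := thicken M eps (piece q).
Definition base v := pixel M eps (p v).
Definition core v x : Prop := exists2 q, owns v q & hat q x.

(** To the sites around the star of [v], the zone adds those around the middle
thirds of the edges selected with [v] as first end, except where they belong to
the star at the second end. *)
Definition zone v x : Prop := core v x \/
  exists d, [/\ oriented d, d.1 = v, hat (mid d) x & ~ core d.2 x].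

(** What the zone keeps of a middle third need not be connected to the star. *)
Definition region v x := linked (zone v) (base v) x.

Lemma hat_disjoint q q' x :
  piece q `&` piece q' = set0 -> hat q x -> ~ hat q' x.
Proof.
move=> qq' [b qb xb] [b' qb' xb'].
have := piece_sep qq' qb qb'; rewrite leNgt => /negP; apply.
exact: pixel_sep (piece_M qb) (piece_M qb') xb xb'.
Qed.

Lemma core_base v : core v (base v).
Proof. by exists (inl v); rewrite /= ?eqxx //; apply: thicken_pixel. Qed.

Lemma core_linked v x : core v x -> linked (core v) (base v) x.
Proof.
case=> -[w|[d k]] vq.
  move=> [b -> xb]; have /eqP wv := vq; subst w.
  apply: linked_sub (thicken_linked (B := [set p v]) _ xb) => // u.
  by exists (inl v).
have /andP[dd vk] := vq; rewrite /hat /piece dd => -[_ [t tk <-] xb].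
apply: (@linked_sub (thicken M eps (g d @` third k))).
  by move=> u ux; exists (inr (d, k)); rewrite // /hat /piece dd.
apply: linked_trans (thicken_linked _ xb); last by exists t.
have [_ _ g0 g1 _] := gP dd.
have gc := @third_continuous d k dd.
suff [t0 t0k vE] : exists2 t0, third k t0 & p v = g d t0.
  by rewrite /base vE; apply: curve_linked.
case/orP: vk => /andP[/eqP <- /eqP kE].
  by exists 0; rewrite // /third /= in_itv /= kE; lra.
by exists 1; rewrite // /third /= in_itv /= kE; lra.
Qed.

Lemma zone_core_disjoint u v x : u != v -> zone u x -> ~ core v x.
Proof.
move=> uv [[q uq ux] [q' vq' vx]|[d [dd dE dx nx]] [q vq vx]].
  exact: hat_disjoint (owns_disjoint uq vq' uv) ux vx.
have [vE|v2] := eqVneq v d.2; first by apply: nx; rewrite -vE; exists q.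
have v1 : v != d.1 by rewrite dE eq_sym.
exact: hat_disjoint (owns_mid_disjoint vq dd v1 v2) vx dx.
Qed.

Lemma zone_disjoint u v x : zone u x -> zone v x -> u = v.
Proof.
move=> ux vx; apply/eqP; apply: contrapT => /negP uv.
case: (vx) => [cvx|[d [dd dE dx _]]]; first exact: zone_core_disjoint uv ux cvx.
case: (ux) => [cux|[d' [dd' dE' dx' _]]].
  by apply: zone_core_disjoint vx cux; rewrite eq_sym.
apply: (hat_disjoint (mid_disjoint dd dd' _) dx dx') => E.
by rewrite -dE -dE' E eqxx in uv.
Qed.

Lemma region_zone v x : region v x -> zone v x.
Proof. by apply: linked_in; left; apply: core_base. Qed.

Lemma core_region v x : core v x -> region v x.
Proof. by move=> /core_linked; apply: linked_sub => u; left. Qed.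

Lemma region_linked v x : region v x -> linked (region v) (base v) x.
Proof.
elim=> [|y z xy IH yz zz]; first exact: linked_refl.
exact: (linked_step IH yz (linked_step xy yz zz)).
Qed.

Lemma region_range v x : region v x ->
  let m := (Num.truncn ((M + M) / eps) + 3)%N in
  (0 < x.1 < m.+1)%N && (0 < x.2 < m.+1)%N.
Proof.
have hat_range q : hat q x -> let m := (Num.truncn ((M + M) / eps) + 3)%N in
    (0 < x.1 < m.+1)%N && (0 < x.2 < m.+1)%N.
  by move=> [b qb xb]; apply: pixel_range xb => //; apply: piece_M qb.
by case/region_zone => [[q _]|[d [_ _ + _]]]; apply: hat_range.
Qed.

(** Along the middle third of [d], every site lies in the zone of [d.1] or in
the star of [d.2], and the last one lies in that star. So the first site
outside the branch set of [d.1] belongs to the branch set of [d.2]. *)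
Lemma oriented_region_adj d : oriented d ->
  exists x y, [/\ region d.1 x, region d.2 y & site_adj x y].
Proof.
move=> dd; set u := d.1; set v := d.2.
have uv : u != v.
  by apply/eqP => E; move: dd => /andP[]; rewrite -/u E adj_irrefl.
have mid_zone y : hat (mid d) y -> core v y \/ zone u y.
  by move=> dy; have [|nv] := pselect (core v y); [left|right; right; exists d].
have step a b : linked (hat (mid d)) a b -> region u a -> region u b \/
    exists x y, [/\ region u x, core v y & site_adj x y].
  elim=> [|y z _ IH yz dz] ua; first by left.
  have [uy|] := IH ua; last by right.
  have [vz|uz] := mid_zone z dz; first by right; exists y, z.
  by left; apply: linked_step uy yz uz.
pose k1 := Ordinal (isT : (1 < 3)%N).
have k1lo : third k1 (1 / 3) by rewrite /third /= in_itv /=; lra.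
have k1hi : third k1 (2 / 3) by rewrite /third /= in_itv /=; lra.
have mid_linked : linked (hat (mid d))
    (pixel M eps (g d (1 / 3))) (pixel M eps (g d (2 / 3))).
  rewrite /hat /piece /mid dd.
  by apply: (curve_linked _ eps_gt0 (@third_continuous d k1 dd)).
have core_u : core u (pixel M eps (g d (1 / 3))).
  exists (inr (d, Ordinal (isT : (0 < 3)%N))); first by rewrite /= dd !eqxx.
  apply: thicken_pixel; rewrite /= dd; exists (1 / 3) => //.
  by rewrite /third /= in_itv /=; lra.
have core_v : core v (pixel M eps (g d (2 / 3))).
  exists (inr (d, Ordinal (isT : (2 < 3)%N))).
    by rewrite /= dd !eqxx orbT.
  apply: thicken_pixel; rewrite /= dd; exists (2 / 3) => //.
  by rewrite /third /= in_itv /=; lra.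
have [/region_zone uz|[x [y [ux vy xy]]]] :=
  step _ _ mid_linked (core_region core_u).
  by case: (zone_core_disjoint uv uz core_v).
by exists x, y; split => //; apply: core_region.
Qed.

End Model.
End Drawing.

Lemma planar_lattice_model (R : realType) (G : sgraph) : planar R G ->
  exists (m : nat) (X : G -> pred site) (base : G -> site),
  [/\ forall v x, X v x -> (0 < x.1 < m.+1)%N && (0 < x.2 < m.+1)%N,
      forall u v x, X u x -> X v x -> u = v,
      forall v, X v (base v),
      forall v x, X v x -> linked (X v) (base v) x &
      forall u v, adj u v -> exists x y, [/\ X u x, X v y & site_adj x y]].
Proof.
move=> [p [A drawing]]; have [g gP] := arcs_param drawing.
have [M [eps [eps_gt0 M_bound sep]]] := compact_family_scale (piece_compact gP).
have region_adj := oriented_region_adj drawing gP eps_gt0 M_bound sep.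
have region_rg := region_range eps_gt0 M_bound.
set m := (Num.truncn ((M + M) / eps) + 3)%N in region_rg.
exists m, (fun v x => `[< region p g M eps v x >]), (base p M eps); split.
- by move=> v x /asboolP; apply: region_rg.
- move=> u v x /asboolP/region_zone ux /asboolP/region_zone vx.
  exact: (zone_disjoint drawing gP eps_gt0 M_bound sep ux vx).
- by move=> v; apply/asboolP; apply: linked_refl.
- move=> v x /asboolP/region_linked; apply: linked_sub => y yv.
  by apply/asboolP.
- move=> u v /adj_oriented[] /region_adj [x [y [/asboolP ux /asboolP vy xy]]].
    by exists x, y.
  by exists y, x; split => //; apply: site_adjC.
Qed.

End PlaneDrawings.

(** * Sparse graphs and planar graphs of girth at least six *)

Lemma in_edges (G : sgraph) (u v : G) : ([set u; v] \in edges G) = adj u v.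
Proof.
apply/imsetP/idP => [[[x y] xy E]|uv]; last by exists (u, v); rewrite ?inE.
rewrite inE /= in xy; move/setP: E => E.
have := E u; have := E v; have := E x; have := E y; rewrite !inE !eqxx !orbT /=.
move=> /orP[]/eqP yE /orP[]/eqP xE /esym/orP[]/eqP vE /esym/orP[]/eqP uE.
all: by move: xy; rewrite ?yE ?xE ?uE ?vE // adj_sym ?yE ?xE ?uE ?vE.
Qed.

Lemma card_edge (G : sgraph) (f : {set G}) : f \in edges G -> #|f| = 2%N.
Proof.
case/imsetP => -[u v]; rewrite inE /= => uv ->; rewrite cards2.
by case: eqVneq uv => // ->; rewrite adj_irrefl.
Qed.

Lemma mad_lt3P (G : sgraph) : reflect
  (forall H : {set G} * {set {set G}}, nonempty_subgraph H ->
     (2 * #|H.2| < 3 * #|H.1|)%N)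
  (mad G < 3).
Proof.
have ratioE (H : {set G} * {set {set G}}) : nonempty_subgraph H ->
    ((2 * #|H.2|)%:R / #|H.1|%:R < 3 :> rat) = (2 * #|H.2| < 3 * #|H.1|)%N.
  case/and3P => H_n0 _ _; rewrite ltr_pdivrMr ?ltr0n ?card_gt0 //.
  by rewrite -natrM ltr_nat.
apply: (iffP idP) => [mad3 H HG|sparse].
  by rewrite -ratioE //; apply: le_lt_trans mad3; apply: le_bigmax_cond.
by apply: bigmax_lt => // H HG; rewrite ratioE //; apply: sparse.
Qed.

Lemma mad_lt3_odd_colorable (G : sgraph) : mad G < 3 -> odd_colorable G 6.
Proof.
move=> /mad_lt3P sparse.
have [||S S_n0|c [c_proper c_odd]] :=
  @sparse_odd_coloring G (@adj G) _ _ _ [set: G].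
- exact: adj_sym.
- exact: adj_irrefl.
- pose ES := [set f in edges G | f \subset S].
  have ES2 f : f \in ES -> #|f| = 2%N by rewrite inE => /andP[/card_edge].
  have := sparse (S, ES).
  rewrite /nonempty_subgraph /= S_n0 /= => /(_ _)/wrap[].
    apply/andP; split; first by apply/subsetP => f; rewrite inE => /andP[].
    by apply/forall_inP => f; rewrite inE => /andP[].
  rewrite -(sum_degrees ES2) => /(leq_ltn_trans _); apply.
  rewrite big_mkcond leq_sum // => v _; case: ifP => // vS.
  apply/subset_leq_card/subsetP => w; rewrite !inE in_edges => /andP[wS ->] /=.
  by apply/subsetP => x /set2P[]->.
apply/existsP; exists (finfun c); apply/andP; split.
  apply/forallP => u; apply/forallP => v; apply/implyP => uv.
  by rewrite !ffunE; apply: c_proper; rewrite ?inE.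
apply/forallP => v; apply/implyP => /existsP[u vu].
have vN : nbhd (@adj G) [set: G] v != set0.
  by apply/set0Pn; exists u; rewrite !inE.
have /existsP[i odd_i] := c_odd v (in_setT v) vN.
apply/existsP; exists i; congr (odd _): odd_i; apply: eq_card => w.
by rewrite !inE ffunE.
Qed.

Lemma mad_lt3_odd_chromatic_number (G : sgraph) :
  mad G < 3 -> (odd_chromatic_number G <= 6)%N.
Proof.
move=> /mad_lt3_odd_colorable G6; rewrite /odd_chromatic_number.
by case: ex_minnP => k _; apply.
Qed.

Lemma girth_cycle (R : realType) (G : sgraph) (s : seq G) :
  (6%:R%:E <= girth R G)%E -> is_cycle s -> (6 <= size s)%N.
Proof.
move=> g6 s_cycle; rewrite -(ler_nat R) -lee_fin; apply: le_trans g6 _.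
by apply: ereal_inf_lbound; exists s.
Qed.

Lemma planar_girth6_mad_lt3 (R : realType) (G : sgraph) :
  planar R G -> (6%:R%:E <= girth R G)%E -> mad G < 3.
Proof.
move=> /planar_lattice_model[m [X [base model]]] g6.
have [X_range X_disj X_base X_linked X_adj] := model.
apply/mad_lt3P => -[U E] /and3P[/= U_n0 /subsetP E_edges /forall_inP E_U].
apply: (lattice_minor_bound U_n0 _ X_range X_disj X_base X_linked).
- by move=> f fE; split; [apply/card_edge/E_edges|apply: E_U].
- by move=> u v /E_edges; rewrite in_edges; apply: X_adj.
- move=> s s3 /andP[s_cyc s_uniq]; apply: (girth_cycle g6).
  rewrite /is_cycle s3 /ucycleb s_uniq andbT /=.
  by apply: sub_cycle s_cyc => v w /E_edges; rewrite in_edges.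
Qed.

Theorem theorem2 (R : realType) :
  (forall G : sgraph, mad G < 3 -> (odd_chromatic_number G <= 6)%N) /\
  (forall G : sgraph, planar R G -> (6%:R%:E <= girth R G)%E ->
     mad G < 3 /\ (odd_chromatic_number G <= 6)%N).
Proof.
split => [G|G G_planar g6]; first exact: mad_lt3_odd_chromatic_number.
have mad3 := planar_girth6_mad_lt3 G_planar g6.
by split => //; apply: mad_lt3_odd_chromatic_number.
Qed.
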